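(* Let $a$ and $b$ be two nonzero distinct complex numbers, and let $f$ be a nonconstant entire function. If $f$ and $f'$ share the value $a$ allowing ramification, and for all $z\in\mathbb{C}$ the equality $f'(z)=b$ implies $f(z)=b$, then $f$ is a transcendental function (i.e. not a polynomial) of order at most one.
   Context: Definition. For an entire function $f$ and a nonzero complex number $a$, $f$ and $f'$ share the value $a$ allowing ramification if for all $z\in\mathbb{C}$: $f(z)=a$ implies $f'(z)\in\{a,0\}$, and $f'(z)=a$ implies $f(z)=a$. The order of a nonconstant entire function $f$ is the usual growth order $\limsup_{r\to\infty}\frac{\log\log \max_{|z|=r}|f(z)|}{\log r}$. *)

(* Defs.v *)
From HB Require Import structures.
From mathcomp Require Import all_boot all_order all_algebra.
From mathcomp Require Import complex.
From mathcomp Require Import all_classical all_reals all_analysis.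

Set Implicit Arguments.
Unset Strict Implicit.
Unset Printing Implicit Defensive.

Import Order.TTheory GRing.Theory Num.Theory.
Import numFieldNormedType.Exports.

Local Open Scope classical_set_scope.
Local Open Scope ring_scope.
Local Open Scope complex_scope.

(* The complex numbers are [R[i]] for [R : realType].  The type [R[i]^o] is
   [R[i]] viewed as a normed module over itself, so that [derivable] and
   [derive1] on functions [R[i]^o -> R[i]^o] are complex differentiability and
   the complex derivative.  The generic norm [`|z|] takes its values in [R[i]];
   [ComplexField.Normc.normc z] is the modulus as an element of [R]. *)

Definition entire (R : realType) (f : R[i]^o -> R[i]^o) : Prop :=
  forall z : R[i]^o, derivable f z 1.

Definition nonconstant (R : realType) (f : R[i]^o -> R[i]^o) : Prop :=
  ~ exists c : R[i]^o, forall z : R[i]^o, f z = c.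

Definition transcendental (R : realType) (f : R[i]^o -> R[i]^o) : Prop :=
  ~ exists p : {poly R[i]}, forall z : R[i]^o, f z = p.[z].

Definition share_allowing_ramification (R : realType) (f g : R[i]^o -> R[i]^o)
    (a : R[i]^o) : Prop :=
  forall z : R[i]^o,
    (f z = a -> g z = a \/ g z = 0) /\ (g z = a -> f z = a).

(* For continuous [f] and [0 <= r] the supremum is a maximum, by compactness
   of the circle. *)
Definition max_modulus (R : realType) (f : R[i]^o -> R[i]^o) (r : R) : R :=
  sup [set ComplexField.Normc.normc (f z) |
        z in [set z : R[i]^o | ComplexField.Normc.normc z = r]].

(* [ln] is 0 on nonpositive reals; for nonconstant entire [f] this only affects
   bounded [r], since then the maximum modulus tends to infinity. *)
Definition growth_order (R : realType) (f : R[i]^o -> R[i]^o) : \bar R :=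
  limf_esup (fun r : R => (ln (ln (max_modulus f r)) / ln r)%:E) +oo%R.

(* Main.v *)
Require Import Defs.
From mathcomp Require Import all_boot all_order all_algebra.
From mathcomp Require Import complex.
From mathcomp Require Import all_classical all_reals all_analysis.
From mathcomp Require Import ring lra.
From mathcomp Require Import zify.

(** Put [F = f - a].

    Polynomials are excluded by algebra ([no_polynomial]): if [p] has degree
    [n >= 2], then [p'' (p - p')] has the roots of [(p' - a) (p' - b)], so that the two
    are proportional, and the multiplicities of the roots of [p' - a] and [p' - b] are
    too restricted for the remaining hypothesis.

    For the order, it suffices to bound [|F'|] on the level set [|F| = 1]
    ([level_bound]).  Indeed, if [|F x| > 1], consider the largest disc about [x] on
    which [|F| > 1].  There [log |F|] is a positive harmonic function that vanishes at
    a boundary point, and Harnack's inequality (in the form of Hopf's lemma)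
    bounds [log |F x|] by the radius times twice the derivative at that boundary
    point ([growth_from_level]).  As the radius is at most [|x|] plus a constant,
    [log |F x|] grows at most linearly ([exp_type]), and the order is at most one.

    The bound on the level set is obtained by Pang's variant of Zalcman's rescaling.
    If there is none, then there are points [x_n] and scales [rho_n] tending to [0] such
    that the functions [g_n z = F (x_n + rho_n z) / rho_n] satisfy
    [|g_n'| <= B (1 + 16 |g_n|^2)] on discs whose radii tend to infinity, and
    [|g_n' 0| = B (1 + |g_n 0|^2)], where [B = |a| + 1].  The first inequality bounds
    [|g_n'|] on the level set [|g_n| = 1], so the [g_n] are uniformly of exponential
    type by the previous argument, and they have an entire limit [g].  Rescaling
    leaves derivatives unchanged: zeros of [g_n] are points where [g_n'] is [a] or [0],
    and [g_n' = a] implies [g_n = 0].  But [g_n' = b] implies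
    [g_n = (b - a) / rho_n], which tends to infinity, so that by Hurwitz's theorem [g'] omits
    [b] or is constant.  Hence [g'] is constant or of the form [b + k exp (c z)].
    Both are impossible ([no_limit]): in the first case [g] has a zero where [g'] is
    neither [a] nor [0], as [|g' 0| >= B]; in the second, [g] would vanish at two
    points that differ by a period of [g'], while [g - b z] is periodic.

    The complex analysis is developed from complex differentiability alone.  Goursat's
    bisection argument for Riemann sums, in logarithmic coordinates, gives the mean value
    formula over circles for functions that are continuous at the centre and
    differentiable elsewhere ([goursat], [mean_value]).  Applied to difference
    quotients, it yields the Cauchy estimates and the differentiability of derivatives
    ([cauchy_estimate], [holo_derivative]).  Logarithms on discs ([log_disc]) then lead to a
    gradient estimate for [log |F|] ([log_gradient]), from which Harnack's inequality
    and Hurwitz's theorem follow ([harnack], [hurwitz_step]). *)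

Import Order.TTheory GRing.Theory Num.Theory.
Import numFieldNormedType.Exports.

Local Open Scope classical_set_scope.
Local Open Scope ring_scope.
Local Open Scope complex_scope.

Local Notation nm := (@ComplexField.Normc.normc _).

Set Implicit Arguments.
Unset Strict Implicit.
Unset Printing Implicit Defensive.

Local Notation Re := complex.Re.
Local Notation Im := complex.Im.

(** * The modulus *)

Lemma nm_ge0 (R : realType) (z : R[i]) : 0 <= nm z.
Proof. by case: z => x y; exact: sqrtr_ge0. Qed.

Lemma nmM (R : realType) (x y : R[i]) : nm (x * y) = nm x * nm y.
Proof. exact: ComplexField.Normc.normcM. Qed.

Lemma nmV (R : realType) (x : R[i]) : nm x^-1 = (nm x)^-1.
Proof. exact: ComplexField.Normc.normcV. Qed.

Lemma nmN (R : realType) (x : R[i]) : nm (- x) = nm x.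
Proof. exact: normcN. Qed.

Lemma nmD (R : realType) (x y : R[i]) : nm (x + y) <= nm x + nm y.
Proof. exact: le_normcD. Qed.

Lemma nmB (R : realType) (x y : R[i]) : nm (x - y) <= nm x + nm y.
Proof. by rewrite -(nmN y) nmD. Qed.

Lemma nm0 (R : realType) : nm (0 : R[i]) = 0.
Proof. exact: ComplexField.Normc.normc0. Qed.

Lemma nm_eq0 (R : realType) (z : R[i]) : (nm z == 0) = (z == 0).
Proof.
apply/eqP/eqP => [|->]; last exact: nm0.
exact: ComplexField.Normc.eq0_normc.
Qed.

Lemma nm_gt0 (R : realType) (z : R[i]) : (0 < nm z) = (z != 0).
Proof. by rewrite lt_def nm_eq0 nm_ge0 andbT. Qed.

Lemma nm_distC (R : realType) (x y : R[i]) : nm (x - y) = nm (y - x).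
Proof. by rewrite -nmN opprB. Qed.

Lemma nm_subl (R : realType) (x y : R[i]) : nm x - nm y <= nm (x - y).
Proof. by rewrite lerBlDr; have := nmD (x - y) y; rewrite subrK. Qed.

Lemma nm_subr (R : realType) (x y : R[i]) : nm y - nm x <= nm (x - y).
Proof. by rewrite nm_distC nm_subl. Qed.

Lemma nm_triangle (R : realType) (x y z : R[i]) :
  nm (x - z) <= nm (x - y) + nm (y - z).
Proof. by rewrite (_ : x - z = (x - y) + (y - z)) ?nmD//; ring. Qed.

Lemma nmE (R : realType) (z : R[i]) : nm z = Num.sqrt (Re z ^+ 2 + Im z ^+ 2).
Proof. by case: z. Qed.

Lemma nm_sqr (R : realType) (z : R[i]) : nm z ^+ 2 = Re z ^+ 2 + Im z ^+ 2.
Proof. by rewrite nmE sqr_sqrtr// addr_ge0// sqr_ge0. Qed.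

Lemma nm_real (R : realType) (x : R) : nm x%:C = `|x|.
Proof. by rewrite nmE/= expr0n/= addr0 sqrtr_sqr. Qed.

Lemma nm_nat (R : realType) (n : nat) : nm (n%:R : R[i]) = n%:R.
Proof. by rewrite -(rmorph_nat (real_complex R)) nm_real ger0_norm. Qed.

Lemma nm_i (R : realType) : nm ('i%C : R[i]) = 1.
Proof. by rewrite nmE/= expr0n/= add0r expr1n sqrtr1. Qed.

Lemma Re_le_nm (R : realType) (z : R[i]) : `|Re z| <= nm z.
Proof.
by rewrite -(ler_pXn2r (_ : 0 < 2)%N)// ?nnegrE ?nm_ge0// nm_sqr real_normK
  ?num_real// lerDl sqr_ge0.
Qed.

Lemma Im_le_nm (R : realType) (z : R[i]) : `|Im z| <= nm z.
Proof.
by rewrite -(ler_pXn2r (_ : 0 < 2)%N)// ?nnegrE ?nm_ge0// nm_sqr real_normK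
  ?num_real// lerDr sqr_ge0.
Qed.

Lemma nm_le_ReIm (R : realType) (z : R[i]) : nm z <= `|Re z| + `|Im z|.
Proof.
rewrite {1}[z]complexE (le_trans (nmD _ _))// nmM nm_i mul1r.
by rewrite !nm_real.
Qed.

Lemma nm_le_eps_eq0 (R : realType) (z : R[i]) (k : R) :
  (forall e, 0 < e -> nm z <= k * e) -> z = 0.
Proof.
move=> h; apply/eqP; rewrite -nm_eq0; apply/eqP/le_anti; rewrite nm_ge0 andbT.
apply/ler_addgt0Pr => e e0; rewrite add0r.
have k1 : 0 < `|k| + 1 by rewrite ltr_wpDl.
have := h (e / (`|k| + 1)) (divr_gt0 e0 k1) => /le_trans; apply.
rewrite mulrCA ler_piMr ?(ltW e0)// ler_pdivrMr// mul1r.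
by rewrite (le_trans (ler_norm _))// lerDl.
Qed.

(** * Complex derivatives *)

(** The norm of [R[i]] takes its values in [R[i]]; here all radii and tolerances are
    real, so that they can be compared in a total order. *)
Definition cderiv (R : realType) (f : R[i] -> R[i]) (z d : R[i]) : Prop :=
  forall e : R, 0 < e -> exists2 t : R, 0 < t &
    forall h, nm h < t -> nm (f (z + h) - f z - d * h) <= e * nm h.

Definition ccont (R : realType) (f : R[i] -> R[i]) (z : R[i]) : Prop :=
  forall e : R, 0 < e -> exists2 t : R, 0 < t &
    forall w, nm (w - z) < t -> nm (f w - f z) < e.

Lemma cderiv_cont (R : realType) (f : R[i] -> R[i]) z d :
  cderiv f z d -> ccont f z.
Proof.
move=> hf e e0; have [t t0 ht] := hf 1 ltr01.
have k0 : 0 < nm d + 1 by rewrite ltr_wpDl ?nm_ge0.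
exists (Num.min t (e / (nm d + 1))); first by rewrite lt_min t0 divr_gt0.
move=> w; rewrite lt_min => /andP[w1 w2].
have := ht _ w1; rewrite mul1r (addrC z) subrK => h1.
have : nm (f w - f z) <= (nm d + 1) * nm (w - z).
  rewrite -[f w - f z](subrK (d * (w - z))) (le_trans (nmD _ _))//.
  by rewrite mulrDl mul1r addrC nmM lerD2l.
by move/le_lt_trans; apply; rewrite mulrC -ltr_pdivlMr.
Qed.

Lemma cderiv_ext (R : realType) (f g : R[i] -> R[i]) z d :
  f =1 g -> cderiv f z d -> cderiv g z d.
Proof. by move=> /funext ->. Qed.

(** Used to redefine a function away from the point, where a denominator might
    vanish. *)
Lemma cderiv_near (R : realType) (f g : R[i] -> R[i]) z d (r : R) : 0 < r ->
  (forall w, nm (w - z) < r -> f w = g w) -> cderiv f z d -> cderiv g z d.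
Proof.
move=> r0 fg hf e e0; have [t t0 ht] := hf e e0.
exists (Num.min t r); first by rewrite lt_min t0.
move=> h; rewrite lt_min => /andP[h1 h2]; rewrite -!fg; first exact: ht.
- by rewrite subrr nm0.
- by rewrite addrAC subrr add0r.
Qed.

Lemma cderiv_cst (R : realType) (c z : R[i]) : cderiv (fun=> c) z 0.
Proof.
move=> e e0; exists 1 => // h _.
by rewrite subrr mul0r subrr nm0 mulr_ge0 ?nm_ge0// ltW.
Qed.

Lemma cderiv_id (R : realType) (z : R[i]) : cderiv id z 1.
Proof.
move=> e e0; exists 1 => // h _.
by rewrite /= mul1r addrAC addrK subrr nm0 mulr_ge0 ?nm_ge0// ltW.
Qed.

Lemma cderivD (R : realType) (f g : R[i] -> R[i]) z d1 d2 :
  cderiv f z d1 -> cderiv g z d2 ->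
  cderiv (fun w => f w + g w) z (d1 + d2).
Proof.
move=> hf hg e e0; have e2 : 0 < e / 2 by lra.
have [t t0 ht] := hf _ e2; have [s s0 hs] := hg _ e2.
exists (Num.min t s); first by rewrite lt_min t0.
move=> h; rewrite lt_min => /andP[/ht h1 /hs h2].
rewrite (_ : _ - _ = (f (z + h) - f z - d1 * h) + (g (z + h) - g z - d2 * h));
  last by ring.
by rewrite (le_trans (nmD _ _))//; lra.
Qed.

(** Caratheodory's form of the derivative turns the product, inverse and chain
    rules into algebra on slopes that are continuous at the point. *)
Lemma cderiv_slope (R : realType) (f : R[i] -> R[i]) z d :
  cderiv f z d <-> exists2 s : R[i] -> R[i], ccont s z /\ s z = d &
    forall w, f w - f z = s w * (w - z).
Proof.
split=> [hf|[s [cs <-] fs] e e0]; last first.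
  have [t t0 ht] := cs e e0; exists t => // h hh.
  rewrite fs addrAC subrr add0r -mulrBl nmM ler_wpM2r ?nm_ge0// ltW// ht//.
  by rewrite addrAC subrr add0r.
exists (fun w => if w == z then d else (f w - f z) / (w - z)).
  rewrite eqxx; split=> // e e0; rewrite eqxx.
  have e2 : 0 < e / 2 by lra.
  have [t t0 ht] := hf _ e2; exists t => // w hw.
  case: eqVneq => [_|wz]; first by rewrite subrr nm0.
  have wz0 : w - z != 0 by rewrite subr_eq0.
  have := ht _ hw; rewrite (addrC z) subrK => h1.
  rewrite (_ : _ - d = (f w - f z - d * (w - z)) / (w - z)); last first.
    by field.
  rewrite nmM nmV ltr_pdivrMr ?nm_gt0// (le_lt_trans h1)// ltr_pM2r ?nm_gt0//.
  lra.
move=> w; case: eqVneq => [->|wz]; first by rewrite !subrr mulr0.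
by rewrite mulfVK// subr_eq0.
Qed.

Lemma ccontD (R : realType) (f g : R[i] -> R[i]) z :
  ccont f z -> ccont g z -> ccont (fun w => f w + g w) z.
Proof.
move=> hf hg e e0; have e2 : 0 < e / 2 by lra.
have [t t0 ht] := hf _ e2; have [s s0 hs] := hg _ e2.
exists (Num.min t s); first by rewrite lt_min t0.
move=> h; rewrite lt_min => /andP[/ht h1 /hs h2].
rewrite (_ : _ - _ = (f h - f z) + (g h - g z)); last by ring.
by rewrite (le_lt_trans (nmD _ _))//; lra.
Qed.

Lemma ccont_cst (R : realType) (c z : R[i]) : ccont (fun=> c) z.
Proof. exact: (cderiv_cont (cderiv_cst c z)). Qed.

Lemma ccontM (R : realType) (f g : R[i] -> R[i]) z :
  ccont f z -> ccont g z -> ccont (fun w => f w * g w) z.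
Proof.
move=> hf hg e e0; pose k := nm (f z) + nm (g z) + 1.
have [fz gz] : 0 <= nm (f z) /\ 0 <= nm (g z) by rewrite !nm_ge0.
have k0 : 0 < k by rewrite /k; lra.
pose u := Num.min 1 (e / (2 * k)).
have u0 : 0 < u by rewrite /u lt_min ltr01 divr_gt0// mulr_gt0.
have uk : u * k <= e / 2.
  have : u <= e / (2 * k) by rewrite /u ge_min lexx orbT.
  by rewrite -(ler_pM2r k0) => /le_trans; apply; rewrite le_eqVlt;
    apply/orP; left; apply/eqP; field; rewrite gt_eqF.
have [t t0 ht] := hf _ u0; have [s s0 hs] := hg _ u0.
exists (Num.min t s); first by rewrite lt_min t0.
move=> h; rewrite lt_min => /andP[/ht h1 /hs h2].
have u1 : u <= 1 by rewrite /u ge_min lexx.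
rewrite (_ : _ - _ = (f h - f z) * (g h - g z) + (f h - f z) * g z
  + f z * (g h - g z)); last by ring.
apply: le_lt_trans (nmD _ _) _.
apply: le_lt_trans (lerD (nmD _ _) (lexx _)) _.
rewrite !nmM.
have p1 := nm_ge0 (f h - f z); have p2 := nm_ge0 (g h - g z).
have q1 : nm (f h - f z) * nm (g h - g z) <= u.
  by rewrite -[leRHS]mulr1 ler_pM// ltW// (lt_le_trans h2).
have q2 : nm (f h - f z) * nm (g z) <= u * nm (g z).
  by rewrite ler_wpM2r// ltW.
have q3 : nm (f z) * nm (g h - g z) <= u * nm (f z).
  by rewrite mulrC ler_wpM2r// ltW.
have : u * k = u + u * nm (g z) + u * nm (f z) by rewrite /k; ring.
lra.
Qed.

Lemma ccontV (R : realType) (f : R[i] -> R[i]) z :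
  f z != 0 -> ccont f z -> ccont (fun w => (f w)^-1) z.
Proof.
move=> fz0 hf e e0; pose m := nm (f z).
have m0 : 0 < m by rewrite nm_gt0.
pose u := Num.min (m / 2) (e * (m * m / 2) / 2).
have u0 : 0 < u.
  by rewrite /u lt_min; apply/andP; split; rewrite !(divr_gt0, mulr_gt0).
have [t t0 ht] := hf _ u0; exists t => // w /ht h1.
have u1 : u <= m / 2 by rewrite /u ge_min lexx.
have u2 : u <= e * (m * m / 2) / 2 by rewrite /u ge_min lexx orbT.
have fw : m / 2 < nm (f w).
  by have := nm_subr (f w) (f z); rewrite -/m; lra.
have fw0 : 0 < nm (f w) by lra.
have fw0' : f w != 0 by rewrite -nm_gt0.
rewrite (_ : _ - _ = (f z - f w) / (f w * f z)); last by field; rewrite fz0 fw0'.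
rewrite nmM nmV ltr_pdivrMr; last by rewrite nmM mulr_gt0// nm_gt0.
rewrite nm_distC nmM -/m.
have : m * m / 2 <= nm (f w) * m by rewrite mulrAC ler_pM2r// ltW.
rewrite -(ler_pM2l e0) => /(lt_le_trans _); apply.
rewrite (lt_le_trans h1)// (le_trans u2)// ler_pdivrMr// ler_peMr//.
  by rewrite mulr_ge0 ?divr_ge0 ?mulr_ge0// ltW.
by rewrite ler1n.
Qed.

Lemma ccont_comp (R : realType) (f g : R[i] -> R[i]) z :
  ccont f z -> ccont g (f z) -> ccont (fun w => g (f w)) z.
Proof.
move=> hf hg e /hg[t /hf[s s0 hs] ht]; exists s => // w /hs; exact: ht.
Qed.

Lemma cderivM (R : realType) (f g : R[i] -> R[i]) z d1 d2 :
  cderiv f z d1 -> cderiv g z d2 ->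
  cderiv (fun w => f w * g w) z (d1 * g z + f z * d2).
Proof.
move=> hf hg; have cg := cderiv_cont hg.
move/cderiv_slope: hf => [s [cs <-] fs]; move/cderiv_slope: hg => [t [ct <-] gt].
apply/cderiv_slope; exists (fun w => s w * g w + f z * t w).
  by split=> //; apply: ccontD; apply: ccontM => //; exact: ccont_cst.
move=> w; rewrite (_ : f w * g w - _ = (f w - f z) * g w + f z * (g w - g z));
  last by ring.
by rewrite fs gt; ring.
Qed.

Lemma cderivV (R : realType) (f : R[i] -> R[i]) z d : f z != 0 ->
  cderiv f z d -> cderiv (fun w => (f w)^-1) z (- d / f z ^+ 2).
Proof.
move=> fz0 hf; have cf := cderiv_cont hf.
have [r r0 hr] := cf (nm (f z)) (eq_ind_r is_true fz0 (nm_gt0 _)).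
move/cderiv_slope: hf => [s [cs <-] fs].
pose g w := if nm (w - z) < r then (f w)^-1 else
  (f z)^-1 - s w / (f w * f z) * (w - z).
apply: (cderiv_near (f := g) r0); first by rewrite /g => w ->.
apply/cderiv_slope; exists (fun w => - (s w / (f w * f z))).
  split; last by rewrite expr2 mulNr.
  rewrite (_ : (fun w => _) = (fun w => (- (f z)^-1) * (s w * (f w)^-1))).
    by apply: ccontM; [exact: ccont_cst|apply: ccontM => //; exact: ccontV].
  by apply/funext => w; rewrite invfM; ring.
move=> w; rewrite /g subrr nm0 r0; case: ifP => [/hr wr|_]; last by ring.
have fw0 : f w != 0.
  apply: contraTneq wr => ->; rewrite sub0r nmN ltxx//.
have -> : (f w)^-1 - (f z)^-1 = - (f w - f z) / (f w * f z).
  by field; rewrite fz0 fw0.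
by rewrite fs; ring.
Qed.

Lemma cderiv_comp (R : realType) (f g : R[i] -> R[i]) z d1 d2 :
  cderiv f z d1 -> cderiv g (f z) d2 ->
  cderiv (fun w => g (f w)) z (d2 * d1).
Proof.
move=> hf; have cf := cderiv_cont hf.
move/cderiv_slope: hf => [s [cs <-] fs]; move/cderiv_slope=> [t [ct <-] gt].
apply/cderiv_slope; exists (fun w => t (f w) * s w).
  by split=> //; apply: ccontM => //; exact: ccont_comp.
by move=> w; rewrite gt fs mulrA.
Qed.

Lemma cderivZ (R : realType) (f : R[i] -> R[i]) (c z d : R[i]) :
  cderiv f z d -> cderiv (fun w => c * f w) z (c * d).
Proof.
move=> hf; have := cderivM (cderiv_cst c z) hf.
by rewrite mul0r add0r.
Qed.

Lemma cderivB (R : realType) (f g : R[i] -> R[i]) z d1 d2 :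
  cderiv f z d1 -> cderiv g z d2 ->
  cderiv (fun w => f w - g w) z (d1 - d2).
Proof.
move=> hf hg; apply: cderivD => //.
have := cderivZ (-1) hg; rewrite mulN1r; apply: cderiv_ext => w.
by rewrite mulN1r.
Qed.

Lemma cderiv_affine (R : realType) (f : R[i] -> R[i]) (x c z d : R[i]) :
  cderiv f (x + c * z) d -> cderiv (fun w => f (x + c * w)) z (c * d).
Proof.
move=> hf; rewrite mulrC; apply: (cderiv_comp (f := fun w => x + c * w)) => //.
have := cderivD (cderiv_cst x z) (cderivZ c (cderiv_id z)).
by rewrite mulr1 add0r.
Qed.

Lemma cderiv_unique (R : realType) (f : R[i] -> R[i]) z d1 d2 :
  cderiv f z d1 -> cderiv f z d2 -> d1 = d2.
Proof.
move=> h1 h2; apply/eqP; rewrite -subr_eq0; apply/eqP.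
apply: (@nm_le_eps_eq0 _ _ 2) => e e0.
have [t t0 ht] := h1 e e0; have [s s0 hs] := h2 e e0.
pose u := Num.min t s / 2.
have m0 : 0 < Num.min t s by rewrite lt_min t0.
have u0 : 0 < u by rewrite /u; lra.
have ut : u < t /\ u < s.
  by apply/andP; rewrite -lt_min /u; lra.
have nu : nm u%:C = u by rewrite nm_real gtr0_norm.
have := ht u%:C; rewrite nu => /(_ ut.1) a1.
have := hs u%:C; rewrite nu => /(_ ut.2) a2.
have : nm ((d1 - d2) * u%:C) <= 2 * e * u.
  rewrite (_ : (d1 - d2) * _ = (f (z + u%:C) - f z - d2 * u%:C) -
     (f (z + u%:C) - f z - d1 * u%:C)); last by ring.
  by rewrite (le_trans (nmB _ _))//; lra.
by rewrite nmM nu ler_pM2r.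
Qed.

Lemma is_derive_Re_line (R : realType) (f : R[i] -> R[i]) (x v d : R[i]) (t : R) :
  cderiv f (x + t%:C * v) d ->
  is_derive t 1 (fun s : R => Re (f (x + s%:C * v))) (Re (d * v)).
Proof.
move=> hf.
suff H : (fun h => h^-1 *: (((fun s : R => Re (f (x + s%:C * v))) \o shift t) (h *: 1)
    - (fun s : R => Re (f (x + s%:C * v))) t)) @ 0^' --> Re (d * v).
  by split; [apply/cvg_ex; exists (Re (d * v))|apply/cvg_lim].
apply/cvgrPdist_le => e e0.
have k0 : 0 < nm v + 1 by rewrite ltr_wpDl ?nm_ge0.
have [s s0 hs] := hf (e / (nm v + 1)) (divr_gt0 e0 k0).
have q0 : 0 < s / (nm v + 1) by exact: divr_gt0.
near=> h; have h0 : h != 0 by near: h; exact: nbhs_dnbhs_neq.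
have hq : `|h| < s / (nm v + 1) by near: h; exact: dnbhs0_lt.
have h0' : 0 < `|h| by rewrite normr_gt0.
rewrite /= /GRing.scale/= mulr1.
have : `|h| * nm v < s.
  rewrite (@le_lt_trans _ _ (`|h| * (nm v + 1)))//; last by rewrite -ltr_pdivlMr.
  by rewrite ler_pM2l// lerDl.
rewrite -nm_real -nmM => /hs; rewrite nmM nm_real.
have -> : x + t%:C * v + h%:C * v = x + (h + t)%:C * v.
  by rewrite rmorphD/=; ring.
set D := f _ - f _ - _ => hD.
have -> : Re (d * v) - h^-1 * (Re (f (x + (h + t)%:C * v)) - Re (f (x + t%:C * v)))
    = - h^-1 * Re D.
  rewrite /D; case: (f (x + (h + t)%:C * v)) => a1 b1.
  case: (f (x + t%:C * v)) => a2 b2; case: (d) => a3 b3; case: (v) => a4 b4 /=.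
  by field.
rewrite normrM normrN normfV mulrC ler_pdivrMr//.
rewrite (le_trans (Re_le_nm D))// (le_trans hD)//.
rewrite [leLHS](_ : _ = e * `|h| * (nm v / (nm v + 1))); last first.
  by field; rewrite gt_eqF.
rewrite ler_piMr ?mulr_ge0 ?(ltW e0)// ler_pdivrMr// mul1r lerDl//.
Unshelve. all: by end_near. Qed.

(** Only the real part of [f] on the segment is differentiated, after a rotation,
    since the real mean value theorem fails for complex values. *)
Lemma cderiv_mvi (R : realType) (f f1 : R[i] -> R[i]) (x v : R[i]) (K : R) :
  (forall t : R, 0 <= t <= 1 -> cderiv f (x + t%:C * v) (f1 (x + t%:C * v)) /\
     nm (f1 (x + t%:C * v)) <= K) ->
  nm (f (x + v) - f x) <= K * nm v.
Proof.
move=> hf; set D := f (x + v) - f x.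
have K0 : 0 <= K.
  by apply: le_trans (hf 0 _).2; rewrite ?nm_ge0// lexx ler01.
have [D0|D0] := eqVneq D 0; first by rewrite D0 nm0 mulr_ge0 ?nm_ge0.
have D0' : 0 < nm D by rewrite nm_gt0.
(* Rotate so that the increment becomes a positive real number. *)
pose c := conjc D / (nm D)%:C.
have cn : nm c = 1.
  rewrite /c nmM nmV nm_real ger0_norm ?nm_ge0//.
  have -> : nm (conjc D) = nm D by rewrite !nmE; case: (D) => ? ? /=; rewrite sqrrN.
  by rewrite divff// gt_eqF.
have cD : c * D = (nm D)%:C.
  rewrite /c mulrAC; have -> : conjc D * D = (nm D)%:C ^+ 2.
    rewrite -rmorphXn/= nm_sqr; case: (D) => u w /=; simpc.
    by congr (_ +i* _); ring.
  by rewrite expr2 mulfK// -nm_gt0 nm_real gtr0_norm.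
clearbody c.
pose g (t : R) := Re (c * f (x + t%:C * v)).
pose dg (t : R) := Re (c * f1 (x + t%:C * v) * v).
have hg (t : R) : 0 <= t <= 1 -> is_derive t 1 g (dg t).
  move=> t01; apply: (@is_derive_Re_line _ (fun w => c * f w)).
  by apply: cderivZ; exact: (hf t t01).1.
have [| |t t01] := @MVT R g dg 0 1 ltr01.
- by move=> t; rewrite in_itv/= => /andP[t0 t1]; apply: hg; rewrite !ltW.
- apply: continuous_in_subspaceT => t; rewrite inE/= in_itv/= => t01.
  apply: differentiable_continuous; apply/derivable1_diffP.
  by have := hg t t01 => -[].
rewrite subr0 mulr1 /g mul1r mul0r addr0 => e.
have : Re (c * D) = dg t by rewrite -e /D mulrBr raddfB.
rewrite cD /= => ->.
have t01' : 0 <= t <= 1.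
  by move: t01; rewrite in_itv/= => /andP[a b]; rewrite !ltW.
rewrite (le_trans (ler_norm _))// (le_trans (Re_le_nm _))// !nmM cn mul1r.
by rewrite ler_wpM2r ?nm_ge0// (hf t t01').2.
Qed.

(** * Dyadic means and Goursat's lemma *)

(** Mean of [phi] over the left endpoints of the [2 ^ n] equal subintervals of
    [[t, t + l]].  The recursion cuts the interval at its midpoint, so that the
    bisection in Goursat's argument is an identity between such means. *)
Fixpoint avg (R : realType) (n : nat) (phi : R -> R[i]) (t l : R) : R[i] :=
  if n is n'.+1 then
    (avg n' phi t (l / 2) + avg n' phi (t + l / 2) (l / 2)) / 2
  else phi t.

Lemma eq_avg (R : realType) n (phi psi : R -> R[i]) t l : 0 <= l ->
  (forall s, t <= s <= t + l -> phi s = psi s) ->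
  avg n phi t l = avg n psi t l.
Proof.
elim: n t l => [|n IH] t l l0 h /=; first by apply: h; rewrite lexx lerDl.
have l2 : 0 <= l / 2 by lra.
by congr (_ / _); congr (_ + _); apply: IH => // s /andP[s1 s2]; apply: h; lra.
Qed.

Lemma nm_avg (R : realType) n (phi : R -> R[i]) t l M : 0 <= l ->
  (forall s, t <= s <= t + l -> nm (phi s) <= M) -> nm (avg n phi t l) <= M.
Proof.
elim: n t l => [|n IH] t l l0 h /=; first by apply: h; rewrite lexx lerDl.
have l2 : 0 <= l / 2 by lra.
rewrite nmM nmV nm_nat ler_pdivrMr//.
have h1 : nm (avg n phi t (l / 2)) <= M.
  by apply: IH => // s /andP[s1 s2]; apply: h; lra.
have h2 : nm (avg n phi (t + l / 2) (l / 2)) <= M.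
  by apply: IH => // s /andP[s1 s2]; apply: h; lra.
by rewrite (le_trans (nmD _ _))//; lra.
Qed.

Lemma avgD (R : realType) n (phi psi : R -> R[i]) t l :
  avg n (fun s => phi s + psi s) t l = avg n phi t l + avg n psi t l.
Proof. by elim: n t l => [|n IH] t l //=; rewrite !IH; ring. Qed.

Lemma avgZ (R : realType) n (c : R[i]) (phi : R -> R[i]) t l :
  avg n (fun s => c * phi s) t l = c * avg n phi t l.
Proof. by elim: n t l => [|n IH] t l //=; rewrite !IH; ring. Qed.

Lemma avg_cst (R : realType) n (c : R[i]) (t l : R) : avg n (fun=> c) t l = c.
Proof. by elim: n t l => [|n IH] t l //=; rewrite !IH; field. Qed.

Lemma avgB (R : realType) n (phi psi : R -> R[i]) t l :
  avg n (fun s => phi s - psi s) t l = avg n phi t l - avg n psi t l.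
Proof. by elim: n t l => [|n IH] t l //=; rewrite !IH; ring. Qed.

Lemma avg_shift (R : realType) n (c : R) (phi : R -> R[i]) t l :
  avg n (fun s => phi (c + s)) t l = avg n phi (c + t) l.
Proof. by elim: n t l => [|n IH] t l //=; rewrite !IH addrA. Qed.

Definition havg (R : realType) n (F : R[i] -> R[i]) (p : R[i]) (l : R) :=
  avg n (fun s => F (p + s%:C)) 0 l.

Definition vavg (R : realType) n (F : R[i] -> R[i]) (p : R[i]) (m : R) :=
  avg n (fun s => F (p + 'i * s%:C)) 0 m.

Lemma havgS (R : realType) n (F : R[i] -> R[i]) p l :
  havg n.+1 F p l = (havg n F p (l / 2) + havg n F (p + (l / 2)%:C) (l / 2)) / 2.
Proof.
rewrite /havg /=; congr ((_ + _) / _); rewrite addrC -avg_shift.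
by congr avg; apply/funext => s; rewrite rmorphD addrA.
Qed.

Lemma vavgS (R : realType) n (F : R[i] -> R[i]) p m :
  vavg n.+1 F p m =
  (vavg n F p (m / 2) + vavg n F (p + 'i * (m / 2)%:C) (m / 2)) / 2.
Proof.
rewrite /vavg /=; congr ((_ + _) / _); rewrite addrC -avg_shift.
by congr avg; apply/funext => s; rewrite rmorphD mulrDr addrA.
Qed.

(** Riemann sum of the contour integral of [F] along the boundary of the
    rectangle with lower left corner [p], width [l] and height [m]. *)
Definition rect (R : realType) n (F : R[i] -> R[i]) (p : R[i]) (l m : R) : R[i] :=
  l%:C * (havg n F p l - havg n F (p + 'i * m%:C) l) +
  'i * m%:C * (vavg n F (p + l%:C) m - vavg n F p m).

Lemma rectS (R : realType) n (F : R[i] -> R[i]) (p : R[i]) (l m : R) :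
  rect n.+1 F p l m =
    rect n F p (l / 2) (m / 2) + rect n F (p + (l / 2)%:C) (l / 2) (m / 2) +
    (rect n F (p + 'i * (m / 2)%:C) (l / 2) (m / 2) +
     rect n F (p + (l / 2)%:C + 'i * (m / 2)%:C) (l / 2) (m / 2)).
Proof.
rewrite /rect !havgS !vavgS.
set x := (l / 2)%:C; set y := (m / 2)%:C.
have -> : l%:C = x + x.
  by rewrite /x -rmorphD; congr real_complex_def; field.
have -> : m%:C = y + y.
  by rewrite /y -rmorphD; congr real_complex_def; field.
have -> : p + 'i * (y + y) + x = p + x + 'i * y + 'i * y by ring.
have -> : p + (x + x) + 'i * y = p + x + 'i * y + x by ring.
have -> : p + 'i * (y + y) = p + 'i * y + 'i * y by ring.
have -> : p + (x + x) = p + x + x by ring.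
have -> : p + 'i * y + x = p + x + 'i * y by ring.
by field.
Qed.

Lemma rectB (R : realType) n (F G : R[i] -> R[i]) (p : R[i]) (l m : R) :
  rect n (fun w => F w - G w) p l m = rect n F p l m - rect n G p l m.
Proof. by rewrite /rect /havg /vavg !avgB; ring. Qed.

(** Opposite sides are sampled at corresponding points, so that the linear parts
    of their sums cancel exactly and not just in the limit. *)
Lemma rect_affine (R : realType) n (x y p : R[i]) (l m : R) :
  rect n (fun w => x + y * w) p l m = 0.
Proof.
have H (q : R[i]) (k : R) (u : R[i]) :
    avg n (fun s : R => x + y * (q + u * s%:C)) 0 k =
    x + y * q + y * u * avg n (fun s => s%:C) 0 k.
  rewrite -avgZ -[x + y * q in RHS](avg_cst n _ 0 k) -avgD.
  by congr avg; apply/funext => s; ring.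
rewrite /rect /havg /vavg.
have H1 (q : R[i]) (k : R) : avg n (fun s : R => x + y * (q + s%:C)) 0 k =
    x + y * q + y * avg n (fun s => s%:C) 0 k.
  have := H q k 1; rewrite mulr1 => <-.
  by congr avg; apply/funext => s; rewrite mul1r.
by rewrite !H1 !H; ring.
Qed.

Lemma nm_rect (R : realType) n (F : R[i] -> R[i]) (p : R[i]) (l m M : R) :
  0 <= l -> 0 <= m ->
  (forall w, Re p <= Re w <= Re p + l -> Im p <= Im w <= Im p + m ->
     nm (F w) <= M) ->
  nm (rect n F p l m) <= 2 * (l + m) * M.
Proof.
case: p => a b l0 m0 h.
have hh q : Im q = b \/ Im q = b + m -> Re q = a -> nm (havg n F q l) <= M.
  move=> q2 q1; apply: nm_avg => // s; rewrite add0r => /andP[s0 s1].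
  case: q q1 q2 => q1 q2 /= -> q3; apply: h; simpc; rewrite /=; first by lra.
  by case: q3 => ->; lra.
have hv q : Re q = a \/ Re q = a + l -> Im q = b -> nm (vavg n F q m) <= M.
  move=> q2 q1; apply: nm_avg => // s; rewrite add0r => /andP[s0 s1].
  case: q q1 q2 => q1 q2 /= -> q3; apply: h; simpc; rewrite /=; last by lra.
  by case: q3 => ->; lra.
rewrite /rect (le_trans (nmD _ _))// !nmM nm_i mul1r !nm_real !ger0_norm//.
have := hh (a +i* b) (or_introl erefl) erefl.
have := hh (a +i* b + 'i * m%:C); simpc => /= /(_ (or_intror erefl) erefl).
have := hv (a +i* b) (or_introl erefl) erefl.
have := hv (a +i* b + l%:C); simpc => /= /(_ (or_intror erefl) erefl).
set v1 := vavg _ _ _ _; set v2 := vavg _ _ _ _.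
set h1 := havg _ _ _ _; set h2 := havg _ _ _ _ => b1 b2 b3 b4.
have c1 : l * nm (h2 - h1) <= l * (2 * M).
  by rewrite ler_wpM2l// (le_trans (nmB _ _))//; lra.
have c2 : m * nm (v1 - v2) <= m * (2 * M).
  by rewrite ler_wpM2l// (le_trans (nmB _ _))//; lra.
rewrite (le_trans (lerD c1 c2))// le_eqVlt; apply/orP; left; apply/eqP; ring.
Qed.

(** Goursat's lemma.  If the Riemann sums of some rectangle did not become small
    relative to the square of its size, the same would be true of one of its
    four quarters, hence of a nested sequence of rectangles; near the common
    point [F] is affine up to a small relative error, and sums of affine
    functions vanish exactly. *)
Lemma goursat (R : realType) (F : R[i] -> R[i]) (p : R[i]) (l m : R) :
  0 < l -> 0 < m ->
  (forall w, Re p <= Re w <= Re p + l -> Im p <= Im w <= Im p + m ->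
     exists d, cderiv F w d) ->
  forall e : R, 0 < e -> exists N, forall n, (N <= n)%N ->
    nm (rect n F p l m) <= e.
Proof.
move=> l0 m0 hF e0' e0'0.
pose good e p l m := exists N, forall n, (N <= n)%N ->
  nm (rect n F p l m) <= e * (l + m) ^+ 2.
suff H e : 0 < e -> good e p l m.
  have lm : 0 < (l + m) ^+ 2 by rewrite exprn_gt0// addr_gt0.
  have [N hN] := H (e0' / (l + m) ^+ 2) (divr_gt0 e0'0 lm).
  by exists N => n /hN; rewrite divfK// gt_eqF.
move=> e0; apply: contrapT => bad0.
have good4 q (a b : R) : good e q (a / 2) (b / 2) ->
    good e (q + (a / 2)%:C) (a / 2) (b / 2) ->
    good e (q + 'i * (b / 2)%:C) (a / 2) (b / 2) ->
    good e (q + (a / 2)%:C + 'i * (b / 2)%:C) (a / 2) (b / 2) -> good e q a b.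
  move=> [N1 h1] [N2 h2] [N3 h3] [N4 h4].
  exists (maxn (maxn N1 N2) (maxn N3 N4)).+1 => -[//|n].
  rewrite ltnS !geq_max => /andP[/andP[/h1 k1 /h2 k2] /andP[/h3 k3 /h4 k4]].
  rewrite rectS (le_trans (nmD _ _))//.
  rewrite (le_trans (lerD (nmD _ _) (nmD _ _)))//.
  rewrite (le_trans (lerD (lerD k1 k2) (lerD k3 k4)))// le_eqVlt.
  by apply/orP; left; apply/eqP; field.
pose step (q : R[i]) (a b : R) : R[i] :=
  if pselect (good e q (a / 2) (b / 2)) then
  if pselect (good e (q + (a / 2)%:C) (a / 2) (b / 2)) then
  if pselect (good e (q + 'i * (b / 2)%:C) (a / 2) (b / 2)) then
  q + (a / 2)%:C + 'i * (b / 2)%:C else q + 'i * (b / 2)%:C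
  else q + (a / 2)%:C else q.
have stepP q a b : ~ good e q a b -> ~ good e (step q a b) (a / 2) (b / 2).
  move=> bad; rewrite /step.
  case: pselect => [g1|//]; case: pselect => [g2|//]; case: pselect => [g3|//].
  by move=> g4; apply: bad; exact: good4.
have stepRe q a b : 0 <= a -> Re q <= Re (step q a b) <= Re q + a / 2.
  move=> a0; case: q => q1 q2; rewrite /step.
  by case: pselect => ?; [case: pselect => ?; [case: pselect => ?|]|];
    simpc; rewrite /=; lra.
have stepIm q a b : 0 <= b -> Im q <= Im (step q a b) <= Im q + b / 2.
  move=> a0; case: q => q1 q2; rewrite /step.
  by case: pselect => ?; [case: pselect => ?; [case: pselect => ?|]|];
    simpc; rewrite /=; lra.
pose P := fix P j := if j is j'.+1 then step (P j') (l / 2 ^+ j') (m / 2 ^+ j')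
  else p.
have p2 j : 0 < (2 : R) ^+ j by rewrite exprn_gt0.
have hS (x : R) j : x / 2 ^+ j.+1 = x / 2 ^+ j / 2.
  by rewrite exprS invfM; ring.
have bad j : ~ good e (P j) (l / 2 ^+ j) (m / 2 ^+ j).
  elim: j => [|j IH]; first by rewrite !expr0 !divr1.
  by rewrite !hS; exact: stepP.
have lj j : 0 < l / 2 ^+ j by rewrite divr_gt0.
have mj j : 0 < m / 2 ^+ j by rewrite divr_gt0.
have nestRe j k :
    Re (P j) <= Re (P (j + k)%N) <= Re (P j) + l / 2 ^+ j - l / 2 ^+ (j + k).
  elim: k => [|k IH]; first by rewrite addn0; lra.
  have := stepRe (P (j + k)%N) _ (m / 2 ^+ (j + k)) (ltW (lj (j + k)%N)).
  by rewrite addnS hS /=; lra.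
have nestIm j k :
    Im (P j) <= Im (P (j + k)%N) <= Im (P j) + m / 2 ^+ j - m / 2 ^+ (j + k).
  elim: k => [|k IH]; first by rewrite addn0; lra.
  have := stepIm (P (j + k)%N) (l / 2 ^+ (j + k)) _ (ltW (mj (j + k)%N)).
  by rewrite addnS hS /=; lra.
have limit (x d : nat -> R) : (forall j, 0 < d j) ->
    (forall j k, x j <= x (j + k)%N <= x j + d j - d (j + k)%N) ->
    exists y, forall j, x j <= y <= x j + d j.
  move=> d0 hx; pose S := [set x j | j in setT].
  have ub j : ubound S (x j + d j).
    move=> _ [k _ <-]; case: (leqP j k) => jk.
      by have := hx j (k - j)%N; rewrite subnKC//; have := d0 k; lra.
    have := hx k (j - k)%N; rewrite subnKC ?(ltnW jk)//.
    by have := d0 j; lra.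
  exists (sup S) => j; apply/andP; split.
    by apply: ub_le_sup; [exists (x 0%N + d 0%N); exact: ub|exists j].
  by apply: ge_sup; [exists (x 0%N), 0%N|exact: ub].
have [x hx] := limit (fun j => Re (P j)) _ lj nestRe.
have [y hy] := limit (fun j => Im (P j)) _ mj nestIm.
have hx0 := hx 0%N; have hy0 := hy 0%N.
rewrite expr0 divr1 /= in hx0; rewrite expr0 divr1 /= in hy0.
have [d hd] := hF (x +i* y) hx0 hy0.
have e2 : 0 < e / 2 by lra.
have [t t0 ht] := hd _ e2.
have lm0 : 0 < l + m by rewrite addr_gt0.
have [j hj] : exists j, (l + m) / 2 ^+ j < t.
  exists (Num.bound ((l + m) / t)); rewrite ltr_pdivrMr// mulrC -ltr_pdivrMr//.
  have /archi_boundP/lt_le_trans -> // : 0 <= (l + m) / t by rewrite divr_ge0 ?ltW.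
  by rewrite -natrX ler_nat ltnW// ltn_expl.
apply: (bad j); exists 0%N => n _.
pose A w := F (x +i* y) - d * (x +i* y) + d * w.
have -> : rect n F (P j) (l / 2 ^+ j) (m / 2 ^+ j) =
    rect n (fun w => F w - A w) (P j) (l / 2 ^+ j) (m / 2 ^+ j).
  by rewrite rectB rect_affine subr0.
have -> : e * (l / 2 ^+ j + m / 2 ^+ j) ^+ 2 =
   2 * (l / 2 ^+ j + m / 2 ^+ j) * (e / 2 * (l / 2 ^+ j + m / 2 ^+ j)).
  by field; rewrite gt_eqF.
apply: nm_rect; rewrite ?ltW// => w hw1 hw2.
have dist : nm (w - (x +i* y)) <= l / 2 ^+ j + m / 2 ^+ j.
  rewrite (le_trans (nm_le_ReIm _))//; case: w hw1 hw2 => w1 w2 /= hw1 hw2.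
  have := hx j; have := hy j => h1 h2; simpc => /=.
  by apply: lerD; rewrite ler_norml; lra.
have := ht (w - (x +i* y)); rewrite -/(A w) => /(_ _)/wrap[].
  by rewrite (le_lt_trans dist)// -mulrDl.
rewrite (addrC (x +i* y)) subrK => h.
rewrite (_ : F w - A w = F w - F (x +i* y) - d * (w - (x +i* y))); last first.
  by rewrite /A; ring.
by rewrite (le_trans h)// ler_pM2l.
Qed.

(** * The complex exponential *)

Lemma is_derive_eps (R : realType) (f : R -> R) (x d : R) :
  is_derive x 1 f d -> forall e : R, 0 < e -> exists2 t : R, 0 < t &
    forall h, `|h| < t -> `|f (x + h) - f x - d * h| <= e * `|h|.
Proof.
move=> [df dv] e e0; rewrite /derivable in df.
have /cvgrPdist_le/(_ _ e0) : h^-1 *: ((f \o shift x) (h *: 1) - f x) @[h --> 0^'] --> d.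
  by rewrite -dv.
move=> /nbhs_ballP[t /= t0 ht]; exists t => // h hh.
have [->|h0] := eqVneq h 0.
  by rewrite addr0 subrr mulr0 subrr normr0 mulr0.
have := ht h; rewrite /ball/= sub0r normrN => /(_ hh h0).
rewrite /= /GRing.scale /= mulr1 => k.
have -> : f (x + h) - f x - d * h = - ((d - h^-1 * (f (h + x) - f x)) * h).
  by rewrite (addrC x h); field.
by rewrite normrN normrM ler_wpM2r.
Qed.

Definition cis (R : realType) (t : R) : R[i] := cos t +i* sin t.

Definition cexp (R : realType) (w : R[i]) : R[i] := (expR (Re w))%:C * cis (Im w).

Lemma nm_cis (R : realType) (t : R) : nm (cis t) = 1.
Proof. by rewrite nmE/= cos2Dsin2 sqrtr1. Qed.

Lemma cisD (R : realType) (s t : R) : cis (s + t) = cis s * cis t.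
Proof. by rewrite /cis cosD sinD; simpc; congr (_ +i* _); ring. Qed.

Lemma cis_neq0 (R : realType) (t : R) : cis t != 0.
Proof. by rewrite -nm_gt0 nm_cis. Qed.

Lemma nm_cexp (R : realType) (w : R[i]) : nm (cexp w) = expR (Re w).
Proof. by rewrite nmM nm_cis mulr1 nm_real gtr0_norm// expR_gt0. Qed.

Lemma cexpD (R : realType) (v w : R[i]) : cexp (v + w) = cexp v * cexp w.
Proof.
by rewrite /cexp !raddfD/= expRD cisD rmorphM/=; ring.
Qed.

Lemma cexp0 (R : realType) : cexp (0 : R[i]) = 1.
Proof. by rewrite /cexp /= expR0 /cis cos0 sin0 mul1r. Qed.

Lemma cexp2pi (R : realType) (w : R[i]) : cexp (w + 'i * (2 * pi)%:C) = cexp w.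
Proof.
rewrite cexpD (_ : cexp ('i * _) = 1) ?mulr1// /cexp.
have [-> ->] : Re ('i * (2 * pi)%:C) = 0 :> R /\ Im ('i * (2 * pi)%:C) = pi *+ 2 :> R.
  by simpc; split => //=; ring.
by rewrite expR0 mul1r /cis cos2pi sin2pi.
Qed.

Lemma cexp_polar (R : realType) (x t : R) :
  cexp (x%:C + 'i * t%:C) = (expR x)%:C * cis t.
Proof.
rewrite /cexp; have [-> -> //] : Re (x%:C + 'i * t%:C) = x :> R /\
  Im (x%:C + 'i * t%:C) = t :> R.
by simpc.
Qed.

Lemma cexp_onto (R : realType) (z : R[i]) : z != 0 -> exists w, cexp w = z.
Proof.
move=> z0; have n0 : 0 < nm z by rewrite nm_gt0.
pose x := Re z / nm z; pose y := Im z / nm z.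
have xy : x ^+ 2 + y ^+ 2 = 1.
  by rewrite !expr_div_n -mulrDl -nm_sqr divff// gt_eqF// exprn_gt0.
have x1 : -1 <= x <= 1.
  by rewrite -ler_norml normrM normfV (ger0_norm (nm_ge0 z)) ler_pdivrMr// mul1r Re_le_nm.
have [t ht] : exists t, cis t = x +i* y.
  have hs : sin (acos x) = `|y|.
    by rewrite sin_acos// -sqrtr_sqr; congr Num.sqrt; rewrite -xy; ring.
  have [y0|y0] := leP 0 y.
    by exists (acos x); rewrite /cis acosK ?hs ?in_itv// ger0_norm.
  by exists (- acos x); rewrite /cis cosN sinN acosK ?hs ?in_itv// ltr0_norm// opprK.
exists (ln (nm z) +i* t); rewrite /cexp /= ht lnK ?posrE//; simpc.
by rewrite /x /y !(mulrC (nm z)) !divfK ?gt_eqF//; case: (z).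
Qed.

Lemma cderiv_cexp (R : realType) (w : R[i]) : cderiv (@cexp R) w (cexp w).
Proof.
suff H0 : cderiv (@cexp R) 0 1.
  have H1 : cderiv (fun v => cexp (- w + 1 * v)) w (1 * 1).
    by apply: cderiv_affine; rewrite mul1r addNr.
  have := cderivZ (cexp w) H1; rewrite !mulr1; apply: cderiv_ext => v.
  by rewrite mul1r -cexpD addrA subrr add0r.
move=> e e0; have e4 : 0 < e / 4 by lra.
have D1 := is_derive_expR (0 : R); rewrite expR0 in D1.
have D2 := is_derive_cos (0 : R); rewrite sin0 oppr0 in D2.
have D3 := is_derive_sin (0 : R); rewrite cos0 in D3.
have [t1 t10 h1] := is_derive_eps D1 e4.
have e8 : 0 < e / 8 by lra.
have [t2 t20 h2] := is_derive_eps D2 e8.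
have [t3 t30 h3] := is_derive_eps D3 e8.
pose t := Num.min (Num.min t1 t2) (Num.min t3 (Num.min 1 (e / 4))).
exists t; first by rewrite !lt_min t10 t20 t30 ltr01 e4.
case=> x y; rewrite !lt_min => /andP[/andP[k1 k2] /and3P[k3 k4 k5]].
have nx := Re_le_nm (x +i* y); have ny := Im_le_nm (x +i* y).
move: k1 k2 k3 k4 k5 nx ny; set h := nm _ => k1 k2 k3 k4 k5 nx ny.
rewrite /= in nx; rewrite /= in ny.
rewrite add0r cexp0.
have {h1} := h1 x (le_lt_trans nx k1); rewrite add0r expR0 mul1r => h1.
have {h2} := h2 y (le_lt_trans ny k2); rewrite add0r cos0 mul0r subr0 => h2.
have {h3} := h3 y (le_lt_trans ny k3); rewrite add0r sin0 mul1r subr0 => h3.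
rewrite (_ : _ - _ = (expR x - 1 - x)%:C * cis y +
  (1 + x)%:C * ((cos y - 1) +i* (sin y - y)) + (x * y)%:C * 'i); last first.
  by rewrite /cexp /cis; simpc; rewrite /=; congr (_ +i* _); ring.
apply: le_trans (nmD _ _) _; apply: le_trans (lerD (nmD _ _) (lexx _)) _.
rewrite !nmM nm_cis nm_i !mulr1 !nm_real.
have c1 : `|expR x - 1 - x| <= e / 4 * h.
  by rewrite (le_trans h1)// ler_pM2l.
have c2 : `|x * y| <= e / 4 * h.
  rewrite normrM; apply: ler_pM => //; exact: le_trans nx (ltW k5).
have c3 : nm ((cos y - 1) +i* (sin y - y)) <= e / 4 * h.
  rewrite (le_trans (nm_le_ReIm _))//= (le_trans (lerD h2 h3))//.
  by have : e / 8 * `|y| <= e / 8 * h; [rewrite ler_pM2l|lra].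
have c4 : `|1 + x| * nm ((cos y - 1) +i* (sin y - y)) <= 2 * (e / 4 * h).
  apply: ler_pM => //; first exact: nm_ge0.
  by rewrite (le_trans (ler_normD _ _))// normr1; lra.
lra.
Qed.

(** * The mean value formula *)

Definition cavg (R : realType) n (psi : R[i] -> R[i]) (r : R) : R[i] :=
  avg n (fun t => psi (r%:C * cis t)) 0 (2 * pi).

Lemma nm_cavg (R : realType) n (psi : R[i] -> R[i]) (r M : R) : 0 <= r ->
  (forall z, nm z = r -> nm (psi z) <= M) -> nm (cavg n psi r) <= M.
Proof.
move=> r0 h; apply: nm_avg; first by rewrite mulr_ge0// pi_ge0.
by move=> t _; apply: h; rewrite nmM nm_cis mulr1 nm_real ger0_norm.
Qed.

(** In the variable [w] with [z = r * cexp w], circles become vertical segments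
    of height [2 * pi], and the horizontal sides of a rectangle over an annulus
    cancel by periodicity; Goursat's lemma thus compares the means over two
    circles, and continuity at the centre evaluates the small one.  The function
    need not be differentiable at the centre: this is what makes the
    formula applicable to difference quotients. *)
Lemma mean_value (R : realType) (psi : R[i] -> R[i]) (r : R) : 0 < r ->
  ccont psi 0 ->
  (forall z, 0 < nm z <= r -> exists d, cderiv psi z d) ->
  forall e : R, 0 < e -> exists N, forall n, (N <= n)%N ->
    nm (cavg n psi r - psi 0) <= e.
Proof.
move=> r0 psi0 dpsi e e0; have e2 : 0 < e / 2 by lra.
have [t t0 ht] := psi0 _ e2.
have pi0 : 0 < pi :> R by exact: pi_gt0.
have [q q0 /andP[q1 qt]] : exists2 q : R, 0 < q & (q < 1) && (r * q < t).
  have m0 : 0 < Num.min (t / r) 1 by rewrite lt_min divr_gt0// ltr01.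
  exists (Num.min (t / r) 1 / 2); first by rewrite divr_gt0.
  have m1 : Num.min (t / r) 1 / 2 < Num.min (t / r) 1.
    by rewrite ltr_pdivrMr// ltr_pMr// ltr1n.
  move: m1; set u := _ / 2; rewrite lt_min => /andP[u1 ->].
  by rewrite mulrC -ltr_pdivlMr.
pose s := - ln q; have s0 : 0 < s by rewrite oppr_gt0 ln_lt0// q0.
pose F w := psi (r%:C * cexp w).
have hF (w : R[i]) : Re (- s%:C) <= Re w <= Re (- s%:C) + s ->
    Im (- s%:C) <= Im w <= Im (- s%:C) + 2 * pi -> exists d, cderiv F w d.
  move=> /= hw _.
  have [|d hd] := dpsi (r%:C * cexp w).
    rewrite nmM nm_real gtr0_norm// nm_cexp mulr_gt0 ?expR_gt0//=.
    rewrite ler_piMr ?(ltW r0)// -expR0 ler_expR; lra.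
  exists (d * (r%:C * cexp w)); apply: cderiv_comp => //.
  by apply: cderivZ; exact: cderiv_cexp.
have pp0 : 0 < 2 * pi :> R by rewrite mulr_gt0.
have [N hN] := goursat s0 pp0 hF (mulr_gt0 e2 pp0).
exists N => n /hN; rewrite /rect.
have -> : havg n F (- s%:C + 'i * (2 * pi)%:C) s = havg n F (- s%:C) s.
  rewrite /havg; congr avg; apply/funext => u; rewrite /F; congr (psi (_ * _)).
  by rewrite addrAC cexp2pi.
rewrite subrr mulr0 add0r addNr.
have hv (x : R) : vavg n F (x%:C) (2 * pi) = cavg n psi (r * expR x).
  rewrite /vavg /cavg; congr avg; apply/funext => u; rewrite /F.
  by rewrite cexp_polar mulrA -rmorphM.
rewrite (_ : 0 = 0%:C)// -rmorphN !hv.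
rewrite expR0 mulr1 opprK lnK ?posrE// !nmM nm_i mul1r nm_real gtr0_norm//.
rewrite mulrC ler_pM2r// => h1.
have h2 : nm (cavg n psi (r * q) - psi 0) <= e / 2.
  rewrite -[X in _ - X](avg_cst n _ 0 (2 * pi)) -avgB.
  apply: nm_avg; first exact: ltW.
  move=> u _; apply: ltW; apply: ht.
  by rewrite subr0 nmM nm_cis mulr1 nm_real gtr0_norm// mulr_gt0.
by have := nm_triangle (cavg n psi r) (cavg n psi (r * q)) (psi 0); lra.
Qed.

Lemma mean_value_le (R : realType) (psi : R[i] -> R[i]) (r M : R) : 0 < r ->
  ccont psi 0 ->
  (forall z, 0 < nm z <= r -> exists d, cderiv psi z d) ->
  (forall z, nm z = r -> nm (psi z) <= M) -> nm (psi 0) <= M.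
Proof.
move=> r0 c0 d0 hM; apply/ler_addgt0Pr => e e0.
have [N /(_ N (leqnn N)) hN] := mean_value r0 c0 d0 e0.
have := nm_cavg N (ltW r0) hM.
by have := nm_subr (cavg N psi r) (psi 0); lra.
Qed.

(** * Limits along a free ultrafilter *)

(** Limits along a free ultrafilter take the place of subsequences: every bounded
    sequence has one, and the same ultrafilter serves for the values of functions at
    all points. *)
Definition ulim (R : realType) (U : set_system nat) (u : nat -> R[i]) (l : R[i]) :=
  forall e : R, 0 < e -> U [set n | nm (u n - l) < e].

Lemma free_ultrafilter : exists U : set_system nat,
  UltraFilter U /\ forall N, U [set n | (N <= n)%N].
Proof.
have [U [UU hU]] := @ultraFilterLemma nat \oo _.
by exists U; split=> // N; apply: hU; exists N.
Qed.

Lemma ultra_real_lim (R : realType) (U : set_system nat) (u : nat -> R) (M : R) :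
  UltraFilter U -> U [set n | `|u n| <= M] ->
  exists l, forall e, 0 < e -> U [set n | `|u n - l| < e].
Proof.
move=> UU hM; have UF := @ultra_proper _ _ UU.
pose S := [set x | U [set n | x <= u n]].
have S0 : S (- M).
  by apply: filterS hM => n /=; rewrite ler_norml => /andP[].
have Sub : ubound S M.
  move=> x /= hx; have [n [/= h1]] := filter_ex (filterI hx hM).
  by rewrite ler_norml => /andP[_]; exact: le_trans.
have Ssup : has_sup S by split; [exists (- M)|exists M].
exists (sup S) => e e0.
have h1 : U [set n | u n < sup S + e].
  have [//|h] := in_ultra_setVsetC [set n | u n < sup S + e] UU.
  have : S (sup S + e).
    by apply: filterS h => n /= /negP; rewrite -leNgt.
  move=> /(ub_le_sup (ex_intro _ M Sub)); rewrite -subr_ge0.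
  by rewrite opprD addrA subrr add0r oppr_ge0 leNgt e0.
have [x Sx hx] := sup_adherent e0 Ssup.
apply: filterS (filterI h1 Sx) => n /= [k1 k2].
by rewrite ltr_norml; apply/andP; split; lra.
Qed.

Lemma ulim_ex (R : realType) (U : set_system nat) (u : nat -> R[i]) (M : R) :
  UltraFilter U -> U [set n | nm (u n) <= M] -> exists l, ulim U u l.
Proof.
move=> UU hM; have UF := @ultra_proper _ _ UU.
have [|x hx] := @ultra_real_lim R U (fun n => Re (u n)) M UU.
  by apply: filterS hM => n /=; exact: le_trans (Re_le_nm _).
have [|y hy] := @ultra_real_lim R U (fun n => Im (u n)) M UU.
  by apply: filterS hM => n /=; exact: le_trans (Im_le_nm _).
exists (x +i* y) => e e0; have e2 : 0 < e / 2 by lra.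
apply: filterS (filterI (hx _ e2) (hy _ e2)) => n /= [h1 h2].
have := nm_le_ReIm (u n - (x +i* y)); case: (u n) h1 h2 => a b /=; simpc => /=.
lra.
Qed.

Lemma ulim_le (R : realType) (U : set_system nat) (u : nat -> R[i]) l (M : R) :
  UltraFilter U -> ulim U u l -> U [set n | nm (u n) <= M] -> nm l <= M.
Proof.
move=> UU hl hM; have UF := @ultra_proper _ _ UU.
apply/ler_addgt0Pr => e e0.
have [n [/= h1 h2]] := filter_ex (filterI (hl e e0) hM).
by have := nm_subr (u n) l; lra.
Qed.

Lemma ulimD (R : realType) (U : set_system nat) (u v : nat -> R[i]) l k :
  UltraFilter U -> ulim U u l -> ulim U v k ->
  ulim U (fun n => u n + v n) (l + k).
Proof.
move=> UU hl hk e e0; have UF := @ultra_proper _ _ UU.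
have e2 : 0 < e / 2 by lra.
apply: filterS (filterI (hl _ e2) (hk _ e2)) => n /= [h1 h2].
rewrite (_ : _ - _ = (u n - l) + (v n - k)); last by ring.
by rewrite (le_lt_trans (nmD _ _))//; lra.
Qed.

Lemma ulimZ (R : realType) (U : set_system nat) (u : nat -> R[i]) l (c : R[i]) :
  UltraFilter U -> ulim U u l -> ulim U (fun n => c * u n) (c * l).
Proof.
move=> UU hl e e0; have UF := @ultra_proper _ _ UU.
have k0 : 0 < nm c + 1 by rewrite ltr_wpDl ?nm_ge0.
apply: filterS (hl _ (divr_gt0 e0 k0)) => n /=.
rewrite -mulrBr nmM ltr_pdivlMr// mulrC; apply: le_lt_trans.
by rewrite ler_wpM2r ?nm_ge0// lerDl.
Qed.

Lemma ulim_cst (R : realType) (U : set_system nat) (l : R[i]) :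
  UltraFilter U -> ulim U (fun=> l) l.
Proof.
move=> UU e e0; have UF := @ultra_proper _ _ UU.
by apply: filterS filterT => n _ /=; rewrite subrr nm0.
Qed.

Lemma ulimB (R : realType) (U : set_system nat) (u v : nat -> R[i]) l k :
  UltraFilter U -> ulim U u l -> ulim U v k ->
  ulim U (fun n => u n - v n) (l - k).
Proof.
move=> UU hl hk; apply: ulimD => //; rewrite -mulN1r.
by under eq_fun do rewrite -mulN1r; exact: ulimZ.
Qed.

Lemma bolzano_weierstrass (R : realType) (z : nat -> R[i]) (M : R) :
  (forall n, nm (z n) <= M) ->
  exists w, forall e : R, 0 < e -> forall N, exists2 n, (N <= n)%N &
    nm (z n - w) < e.
Proof.
move=> hM; have [U [UU hU]] := free_ultrafilter.
have UF := @ultra_proper _ _ UU.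
have [|w hw] := @ulim_ex R U z M UU; first by apply: filterS filterT => n _ /=.
exists w => e e0 N.
by have [n [/= h1 h2]] := filter_ex (filterI (hU N) (hw e e0)); exists n.
Qed.

Lemma locally_bounded_disc (R : realType) (m : R[i] -> R) (r : R) :
  (forall z, exists K, exists2 t : R, 0 < t & forall w, nm (w - z) < t -> m w <= K) ->
  exists K, forall z, nm z <= r -> m z <= K.
Proof.
move=> hm; apply: contrapT => /forallNP nK.
have /choice[z hz] : forall n : nat, exists z, nm z <= r /\ n%:R < m z.
  move=> n; have /existsNP[z hz] := nK n%:R.
  by exists z; move/not_implyP: hz => [h1 /negP h2]; rewrite ltNge.
have [w hw] := bolzano_weierstrass (fun n => (hz n).1).
have [K [t t0 ht]] := hm w.
have [n hn /ht h1] := hw t t0 (Num.bound `|K|).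
have := (hz n).2; rewrite ltNge (le_trans h1)//.
rewrite (le_trans (ler_norm _))// ltW//.
by rewrite (lt_le_trans (archi_boundP (normr_ge0 K)))// ler_nat.
Qed.

Lemma ccont_bounded (R : realType) (f : R[i] -> R[i]) (z : R[i]) (r : R) :
  (forall w, ccont f w) -> exists M, forall w, nm (w - z) <= r -> nm (f w) <= M.
Proof.
move=> cf; have [|K hK] := @locally_bounded_disc R (fun w => nm (f w)) (nm z + r).
  move=> w; exists (nm (f w) + 1); have [t t0 ht] := cf w 1 ltr01.
  exists t => // v /ht h; have := nm_subl (f v) (f w); lra.
exists K => w hw; apply: hK.
by have := nm_subl w z; lra.
Qed.

(** * Cauchy estimates and higher derivatives *)

Definition holo (R : realType) (f f1 : R[i] -> R[i]) := forall z, cderiv f z (f1 z).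

Lemma holo_cont (R : realType) (f f1 : R[i] -> R[i]) z : holo f f1 -> ccont f z.
Proof. by move=> hf; exact: cderiv_cont (hf z). Qed.

Lemma cderiv_shift (R : realType) (f : R[i] -> R[i]) (x z d : R[i]) :
  cderiv f (x + z) d -> cderiv (fun w => f (x + w)) z d.
Proof.
move=> hf; have := @cderiv_affine R f x 1 z d; rewrite !mul1r => /(_ hf).
by apply: cderiv_ext => w; rewrite mul1r.
Qed.

(** The difference quotient, extended to the centre by the derivative, is the kind
    of function that [mean_value] allows. *)
Lemma slope_center (R : realType) (f : R[i] -> R[i]) (z d : R[i]) :
  cderiv f z d ->
  let psi h := if h == 0 then d else (f (z + h) - f z) / h in
  [/\ ccont psi 0, psi 0 = d &
    forall h, h != 0 -> (exists d', cderiv f (z + h) d') ->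
    exists d', cderiv psi h d'].
Proof.
move=> hf psi; rewrite {2}/psi eqxx; split=> //.
  move/cderiv_slope: hf => [s [cs sd] fs].
  suff -> : psi = (fun h => s (z + h)).
    by apply: (ccont_comp (f := fun h => z + h)); [apply: ccontD; [exact: ccont_cst|
      exact: cderiv_cont (cderiv_id _)]|rewrite addr0].
  apply/funext => h; rewrite /psi; case: eqVneq => [->|h0]; first by rewrite addr0.
  by rewrite fs addrAC subrr add0r mulfK.
move=> h h0 [d' hd'].
have [e he] : exists e, cderiv (fun w => (f (z + w) - f z) * w^-1) h e.
  eexists; apply: cderivM; first apply: cderivB.
  - exact: (cderiv_shift hd').
  - exact: cderiv_cst.
  - by apply: cderivV => //; exact: cderiv_id.
exists e; apply: (cderiv_near (r := nm h)) he; first by rewrite nm_gt0.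
move=> w hw; rewrite /psi; case: eqVneq => // w0.
by move: hw; rewrite w0 sub0r nmN ltxx.
Qed.

Lemma cauchy_estimate (R : realType) (f : R[i] -> R[i]) (z d : R[i]) (r M : R) :
  0 < r -> cderiv f z d ->
  (forall w, nm (w - z) <= r -> exists d', cderiv f w d') ->
  (forall w, nm (w - z) = r -> nm (f w - f z) <= M) -> nm d <= M / r.
Proof.
move=> r0 hd hf hM; have [c0 p0 hs] := slope_center hd.
rewrite -[d in nm d]p0; apply: (mean_value_le r0 c0).
  move=> h /andP[h0 hr]; apply: hs; first by rewrite -nm_gt0.
  by apply: hf; rewrite addrAC subrr add0r.
move=> h hr; have h0 : h != 0 by rewrite -nm_gt0 hr.
rewrite (negbTE h0) nmM nmV hr ler_pM2r ?invr_gt0//.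
by apply: hM; rewrite addrAC subrr add0r.
Qed.

Lemma cauchy_estimate_unit (R : realType) (f f1 : R[i] -> R[i]) (z : R[i]) (M : R) :
  holo f f1 -> (forall w, nm (w - z) <= 1 -> nm (f w) <= M) ->
  nm (f1 z) <= 2 * M.
Proof.
move=> hf hM; have h0 : nm (f z) <= M by apply: hM; rewrite subrr nm0.
rewrite -[2 * M]divr1; apply: (cauchy_estimate (f := f) (z := z)) => //.
  by move=> w _; exists (f1 w).
move=> w hw; rewrite (le_trans (nmB _ _))//.
by have := hM w; rewrite hw lexx => /(_ isT); lra.
Qed.

(** [mean_value] for the difference quotient.  This is the only integral formula on
    which the regularity of derivatives rests. *)
Lemma derivative_mean (R : realType) (f f1 : R[i] -> R[i]) (z : R[i]) : holo f f1 ->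
  forall e : R, 0 < e -> exists N, forall n, (N <= n)%N ->
  nm (cavg n (fun h => (f (z + h) - f z) / h) 1 - f1 z) <= e.
Proof.
move=> hf e e0; have [c0 p0 hs] := slope_center (hf z).
have [|N hN] := mean_value ltr01 c0 _ e0.
  by move=> h /andP[h0 _]; apply: hs; [rewrite -nm_gt0|exists (f1 (z + h))].
exists N => n /hN; rewrite p0.
rewrite (_ : cavg n _ 1 = cavg n (fun h => (f (z + h) - f z) / h) 1)//.
apply: eq_avg; first by rewrite mulr_ge0// pi_ge0.
by move=> t _; rewrite mul1r (negbTE (cis_neq0 t)).
Qed.

Lemma cavgB (R : realType) n (phi psi : R[i] -> R[i]) (r : R) :
  cavg n (fun h => phi h - psi h) r = cavg n phi r - cavg n psi r.
Proof. exact: avgB. Qed.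

Lemma cavgZ (R : realType) n (c : R[i]) (phi : R[i] -> R[i]) (r : R) :
  cavg n (fun h => c * phi h) r = c * cavg n phi r.
Proof. exact: avgZ. Qed.

(** Estimates that depend only on a bound for [f] on the disc of radius 4; each
    step to a further derivative or increment costs one unit of radius. *)
Section SecondOrder.

Context (R : realType) (f f1 : R[i] -> R[i]) (z : R[i]) (M : R).
Hypotheses (hf : holo f f1) (hM : forall w, nm (w - z) <= 4 -> nm (f w) <= M).

Let dist (w u v : R[i]) : nm (w + u - v) <= nm (w - v) + nm u.
Proof. by rewrite addrAC nmD. Qed.

Let distZ (t : R) (h : R[i]) : 0 <= t <= 1 -> nm (t%:C * h) <= nm h.
Proof.
move=> /andP[t0 t1].
by rewrite nmM nm_real ger0_norm// ler_piMl ?nm_ge0.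
Qed.

Lemma bounded_derivative w : nm (w - z) <= 3 -> nm (f1 w) <= 2 * M.
Proof.
move=> hw; apply: (cauchy_estimate_unit hf) => v hv; apply: hM.
by have := nm_triangle v w z; lra.
Qed.

Lemma bounded_increment w h : nm (w - z) <= 2 -> nm h <= 1 ->
  nm (f (w + h) - f w) <= 2 * M * nm h.
Proof.
move=> hw hh; apply: (cderiv_mvi (f1 := f1)) => t t01; split; first exact: hf.
apply: bounded_derivative; have := dist w (t%:C * h) z.
by have := distZ h t01; lra.
Qed.

Lemma bounded_derivative_increment w h : nm (w - z) <= 1 -> nm h <= 1 ->
  nm (f1 (w + h) - f1 w) <= 4 * M * nm h.
Proof.
move=> hw hh; apply/ler_addgt0Pr => e e0.
have e2 : 0 < e / 2 by lra.
have [N1 /(_ (maxn N1 _) (leq_maxl _ _)) h1] := derivative_mean (w + h) hf e2.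
have [N2 /(_ (maxn _ N2) (leq_maxr _ _)) h2] := derivative_mean w hf e2.
have := h1 N2; have {h1 h2} := h2 N1; set n := maxn N1 N2.
set A := cavg _ _ _; set B := cavg _ _ _ => h1 h2.
have h3 : nm (B - A) <= 4 * M * nm h.
  rewrite -cavgB; apply: nm_cavg => // v v1.
  rewrite -mulrBl nmM nmV v1 invr1 mulr1.
  rewrite (_ : _ - _ = (f (w + v + h) - f (w + v)) - (f (w + h) - f w)); last first.
    by rewrite (addrAC w v h); ring.
  rewrite (le_trans (nmB _ _))//.
  have k1 := @bounded_increment (w + v) h; have k2 := @bounded_increment w h.
  have k3 : nm (w + v - z) <= 2 by have := dist w v z; lra.
  by have := k1 k3 hh; have := k2 (le_trans hw _) hh; rewrite ler1n => /(_ isT); lra.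
rewrite (_ : _ - _ = (B - A) - (B - f1 (w + h)) + (A - f1 w)); last by ring.
rewrite (le_trans (nmD _ _))// (le_trans (lerD (nmB _ _) (lexx _)))//; lra.
Qed.

Lemma taylor2 w h : nm (w - z) <= 1 -> nm h <= 1 ->
  nm (f (w + h) - f w - f1 w * h) <= 4 * M * nm h ^+ 2.
Proof.
move=> hw hh; pose g v := f v - f1 w * v.
rewrite (_ : _ - _ = g (w + h) - g w); last by rewrite /g; ring.
rewrite expr2 mulrA; apply: (cderiv_mvi (f1 := fun v => f1 v - f1 w)) => t t01.
split.
  apply: cderivB => //; have := cderivZ (f1 w) (cderiv_id (w + t%:C * h)).
  by rewrite mulr1.
have tn := distZ h t01.
have th : nm (t%:C * h) <= 1 by lra.
rewrite /= (le_trans (bounded_derivative_increment hw th))//.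
have M0 : 0 <= M by apply: (le_trans (nm_ge0 (f z))); apply: hM; rewrite subrr nm0.
by rewrite ler_wpM2l// mulr_ge0.
Qed.

End SecondOrder.

(** The difference quotients of [f1] at [z] are circle means of those of [f] at
    the points of the circle, where the error is uniform by [taylor2]. *)
Lemma holo_derivative (R : realType) (f f1 : R[i] -> R[i]) :
  holo f f1 -> exists f2, holo f1 f2.
Proof.
move=> hf; suff /choice[f2 hf2] : forall z, exists d, cderiv f1 z d by exists f2.
move=> z; have [M hM] := ccont_bounded z 4 (fun w => holo_cont w hf).
have [U [UU hU]] := free_ultrafilter; have UF := @ultra_proper _ _ UU.
pose q n := cavg n (fun v => (f1 (z + v) - f1 z) / v) 1.
have M0 : 0 <= M by apply: (le_trans (nm_ge0 (f z))); apply: hM; rewrite subrr nm0.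
have [|c hc] := @ulim_ex R U q (4 * M) UU.
  apply: filterS filterT => n _ /=; apply: nm_cavg => // v v1.
  rewrite nmM nmV v1 invr1 mulr1 -[leRHS]mulr1 -{2}v1.
  by apply: (bounded_derivative_increment hf hM); rewrite ?subrr ?nm0// v1.
exists c.
have key h : nm h <= 1 -> nm (f1 (z + h) - f1 z - c * h) <= 8 * M * nm h ^+ 2.
  move=> hh; apply/ler_addgt0Pr => e e0.
  have e3 : 0 < e / 3 by lra.
  have [N1 h1] := derivative_mean (z + h) hf e3.
  have [N2 h2] := derivative_mean z hf e3.
  have [n [[/= n1 n2] h3]] := filter_ex (filterI (filterI (hU N1) (hU N2)) (hc _ e3)).
  move: {h1 h2} (h1 n n1) (h2 n n2) h3; rewrite /q.
  set A := cavg _ _ _; set B := cavg _ _ _; set C := cavg _ _ _ => h1 h2 h3.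
  have h4 : nm (A - B - h * C) <= 8 * M * nm h ^+ 2.
    rewrite -cavgB -cavgZ -cavgB; apply: nm_cavg => // v v1.
    rewrite (_ : _ - _ = ((f (z + v + h) - f (z + v) - f1 (z + v) * h) -
       (f (z + h) - f z - f1 z * h)) / v); last by rewrite (addrAC z v h); ring.
    rewrite nmM nmV v1 invr1 mulr1 (le_trans (nmB _ _))//.
    have k1 := @taylor2 R f f1 z M hf hM (z + v) h.
    have k2 := @taylor2 R f f1 z M hf hM z h.
    have := k1 _ hh; rewrite addrAC subrr add0r v1 lexx => /(_ isT).
    have := k2 _ hh; rewrite subrr nm0 => /(_ ler01); lra.
  have h5 : nm (h * (C - c)) <= e / 3.
    by rewrite nmM -[leRHS]mul1r ler_pM ?nm_ge0// ltW.
  rewrite (_ : _ - _ = (A - B - h * C) - (A - f1 (z + h)) + (B - f1 z) + h * (C - c));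
    last by ring.
  apply: le_trans (nmD _ _) _; apply: le_trans (lerD (nmD _ _) (lexx _)) _.
  apply: le_trans (lerD (lerD (nmB _ _) (lexx _)) (lexx _)) _.
  lra.
move=> e e0; have k0 : 0 < 8 * M + 1 by lra.
exists (Num.min 1 (e / (8 * M + 1))); first by rewrite lt_min ltr01 divr_gt0.
move=> h; rewrite lt_min => /andP[/ltW h1]; rewrite ltr_pdivlMr// => h2.
apply: le_trans (key h h1) _; rewrite expr2 mulrA ler_wpM2r ?nm_ge0//.
by rewrite (le_trans _ (ltW h2))// mulrC ler_wpM2l ?nm_ge0//; lra.
Qed.

Lemma holo_const (R : realType) (f f1 : R[i] -> R[i]) :
  holo f f1 -> (forall z, f1 z = 0) -> forall z, f z = f 0.
Proof.
move=> hf f0 z; apply/eqP; rewrite -subr_eq0 -nm_eq0 -{1}[z]add0r.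
apply/eqP/le_anti; rewrite nm_ge0 andbT -[leRHS](mul0r (nm z)).
by apply: (cderiv_mvi (f1 := f1)) => t _; split; [exact: hf|rewrite f0 nm0].
Qed.

Lemma liouville (R : realType) (f f1 : R[i] -> R[i]) (M : R) :
  holo f f1 -> (forall z, nm (f z) <= M) -> forall z, f z = f 0.
Proof.
move=> hf hM; apply: (holo_const hf) => z.
have M0 : 0 <= M by exact: le_trans (nm_ge0 (f 0)) (hM 0).
apply: (@nm_le_eps_eq0 _ _ (2 * M)) => e e0.
rewrite -[e]invrK; apply: (cauchy_estimate (f := f) (z := z)) => //.
- by rewrite invr_gt0.
- by move=> w _; exists (f1 w).
- by move=> w _; rewrite (le_trans (nmB _ _))//; have := hM w; have := hM z; lra.
Qed.

(** The remainder estimate of [taylor2] depends only on a bound for the functions,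
    hence passes to the limit.  Together with the existence of limits along an
    ultrafilter, this takes the place of Montel's theorem. *)
Lemma holo_ulim (R : realType) (U : set_system nat) (g g1 : nat -> R[i] -> R[i])
    (l l1 : R[i] -> R[i]) : UltraFilter U ->
  (forall n, holo (g n) (g1 n)) ->
  (forall r : R, exists M, U [set n | forall z, nm z <= r -> nm (g n z) <= M]) ->
  (forall z, ulim U (fun n => g n z) (l z)) ->
  (forall z, ulim U (fun n => g1 n z) (l1 z)) -> holo l l1.
Proof.
move=> UU hg hM hl hl1 z; have UF := @ultra_proper _ _ UU.
have [M hUM] := hM (nm z + 4).
have key h : nm h <= 1 -> nm (l (z + h) - l z - l1 z * h) <= 4 * M * nm h ^+ 2.
  move=> hh; rewrite (mulrC (l1 z)).
  have hlim : ulim U (fun n => g n (z + h) - g n z - h * g1 n z)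
      (l (z + h) - l z - h * l1 z).
    by apply: ulimB => //; [exact: ulimB|exact: ulimZ].
  apply: ulim_le hlim _; apply: filterS hUM => n /= hn.
  rewrite mulrC; apply: (@taylor2 R _ _ z) => //; last by rewrite subrr nm0.
  by move=> w hw; apply: hn; have := nm_subl w z; lra.
have M0 : 0 <= M.
  have [n /= hn] := filter_ex hUM.
  by apply: le_trans (nm_ge0 (g n z)) (hn _ _); rewrite lerDl.
move=> e e0; have k0 : 0 < 4 * M + 1 by lra.
exists (Num.min 1 (e / (4 * M + 1))); first by rewrite lt_min ltr01 divr_gt0.
move=> h; rewrite lt_min => /andP[/ltW h1]; rewrite ltr_pdivlMr// => h2.
apply: le_trans (key h h1) _; rewrite expr2 mulrA ler_wpM2r ?nm_ge0//.
by rewrite (le_trans _ (ltW h2))// mulrC ler_wpM2l ?nm_ge0//; lra.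
Qed.

(** * Logarithms and Harnack's inequality *)

(** The principal logarithm on the right half-plane, where the argument is
    [atan (Im w / Re w)]. *)
Definition clog (R : realType) (w : R[i]) : R[i] :=
  ln (nm w) +i* atan (Im w / Re w).

Lemma cexp_clog (R : realType) (w : R[i]) : 0 < Re w -> cexp (clog w) = w.
Proof.
move=> w0; have w1 : w != 0.
  by apply: contraTneq w0 => ->; rewrite ltxx.
have n0 : 0 < nm w by rewrite nm_gt0.
rewrite /cexp /clog /= lnK ?posrE//.
set q := Im w / Re w.
have c0 : cos (atan q) = Re w / nm w.
  rewrite cos_atan; have -> : 1 + q ^+ 2 = (nm w / Re w) ^+ 2.
    by rewrite !expr_div_n nm_sqr /q; field; rewrite gt_eqF.
  by rewrite sqrtr_sqr ger0_norm ?invf_div// divr_ge0// ltW.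
have s0 : sin (atan q) = Im w / nm w.
  have := atanK q; rewrite /tan => /(canRL (mulfVK _)) ->; last first.
    by rewrite c0 mulf_neq0 ?invr_eq0// gt_eqF.
  by rewrite c0 /q; field; rewrite !gt_eqF.
rewrite /cis c0 s0; simpc; rewrite !(mulrC (nm w)) !divfK ?gt_eqF//.
by case: (w).
Qed.

Lemma nm_realB (R : realType) (x y : R) : nm (x%:C - y%:C) = `|x - y|.
Proof. by rewrite -rmorphB nm_real. Qed.

Lemma ccont_real (R : realType) (g : R[i] -> R) (phi : R -> R) (z : R[i]) :
  ccont (fun w => (g w)%:C) z -> {for g z, continuous phi} ->
  ccont (fun w => (phi (g w))%:C) z.
Proof.
move=> cg /cvgrPdist_lt hphi e e0.
have /nbhs_ballP[t t0 ht] := hphi e e0.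
have [s s0 hs] := cg t t0; exists s; first by [].
move=> w /hs; rewrite !nm_realB => h; rewrite distrC; apply: ht.
by move: h; rewrite -ball_normE /ball_/= distrC.
Qed.

Lemma ccont_Lip (R : realType) (g : R[i] -> R) (z : R[i]) :
  (forall w, `|g w - g z| <= nm (w - z)) -> ccont (fun w => (g w)%:C) z.
Proof.
move=> hg e e0; exists e; first by [].
by move=> w; apply: le_lt_trans; rewrite nm_realB.
Qed.

Lemma ccont_clog (R : realType) (w : R[i]) : 0 < Re w -> ccont (@clog R) w.
Proof.
move=> w0; have w1 : w != 0.
  by apply: contraTneq w0 => ->; rewrite ltxx.
have cRe : ccont (fun v => (Re v)%:C) w.
  by apply: ccont_Lip => v; rewrite -raddfB; exact: Re_le_nm.
have cIm : ccont (fun v => (Im v)%:C) w.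
  by apply: ccont_Lip => v; rewrite -raddfB; exact: Im_le_nm.
have cnm : ccont (fun v => (nm v)%:C) w.
  apply: ccont_Lip => v; have := nm_subl v w; have := nm_subr v w.
  by rewrite ler_norml => *; lra.
have -> : @clog R = fun v => (ln (nm v))%:C + 'i * (atan (Im v / Re v))%:C.
  by apply/funext => v; rewrite /clog; simpc.
apply: ccontD.
  by apply: (ccont_real cnm); apply: continuous_ln; rewrite nm_gt0.
apply: ccontM; first exact: ccont_cst.
apply: (@ccont_real _ (fun v => Im v / Re v) (@atan R)); last exact: continuous_atan.
rewrite (_ : (fun v => _) = (fun v => (Im v)%:C * ((Re v)%:C)^-1)); last first.
  by apply/funext => v; rewrite rmorphM fmorphV.
apply: ccontM => //; apply: ccontV => //.
by apply/eqP => -[/eqP]; rewrite gt_eqF.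
Qed.

Lemma cderiv_inverse (R : realType) (E L : R[i] -> R[i]) (w d : R[i]) (r : R) :
  0 < r -> (forall v, nm (v - w) < r -> E (L v) = v) -> ccont L w ->
  cderiv E (L w) d -> d != 0 -> cderiv L w d^-1.
Proof.
move=> r0 hEL cL /cderiv_slope[s [cs sd] hs] d0.
have cS : ccont (fun v => s (L v)) w by exact: ccont_comp.
have sn : 0 < nm (s (L w)) by rewrite sd nm_gt0.
have [t t0 ht] := cS _ sn.
pose g v := if nm (v - w) < Num.min r t then L v else L w + (s (L v))^-1 * (v - w).
have m0 : 0 < Num.min r t by rewrite lt_min r0.
apply: (cderiv_near (f := g) m0).
  by move=> v; rewrite /g => ->.
apply/cderiv_slope; exists (fun v => (s (L v))^-1).
  by split; [apply: ccontV => //; rewrite sd|rewrite sd].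
move=> v; rewrite /g subrr nm0 m0.
case: ifP => [|_]; last by ring.
rewrite lt_min => /andP[vr vt].
have := hs (L v); rewrite !hEL ?subrr ?nm0// => ->.
rewrite mulKf//; apply: contraTneq (ht v vt) => ->.
by rewrite sub0r nmN ltxx.
Qed.

Lemma cderiv_clog (R : realType) (w : R[i]) : 0 < Re w -> cderiv (@clog R) w w^-1.
Proof.
move=> w0; have w1 : w != 0.
  by apply: contraTneq w0 => ->; rewrite ltxx.
have hd := cderiv_cexp (clog w); rewrite cexp_clog// in hd.
apply: (cderiv_inverse w0 _ (ccont_clog w0) hd w1) => v hv; apply: cexp_clog.
have := Re_le_nm (v - w).
by rewrite raddfB/= ler_norml => /andP[h _]; lra.
Qed.

(** Otherwise, by compactness, pairs of points with bad ratios would accumulate at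
    a point of the disc, where [F] is continuous and does not vanish. *)
Lemma uniform_ratio (R : realType) (F : R[i] -> R[i]) (r : R) : 0 < r ->
  (forall z, nm z <= r -> ccont F z) -> (forall z, nm z <= r -> F z != 0) ->
  exists N : nat, forall z w, nm z <= r -> nm w <= r ->
    nm (z - w) <= r / N.+1%:R -> nm (F z / F w - 1) < 1.
Proof.
move=> r0 cF F0; apply: contrapT => /forallNP nN.
have /choice[zw hzw] : forall N : nat, exists zw : R[i] * R[i],
    [/\ nm zw.1 <= r, nm zw.2 <= r, nm (zw.1 - zw.2) <= r / N.+1%:R &
        ~ nm (F zw.1 / F zw.2 - 1) < 1].
  move=> N; apply: contrapT => /forallNP h; apply: (nN N) => z w hz hw hd.
  by apply: contrapT => hn; apply: (h (z, w)).
have [|x hx] := @bolzano_weierstrass R (fun n => (zw n).1) r.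
  by move=> n; case: (hzw n).
have xr : nm x <= r.
  apply/ler_addgt0Pr => e e0; have [n _ hn] := hx e e0 0%N.
  by case: (hzw n) => h1 _ _ _; have := nm_subr (zw n).1 x; lra.
have x0 : 0 < nm (F x) by rewrite nm_gt0 F0.
have x4 : 0 < nm (F x) / 4 by lra.
have [t t0 ht] := cF x xr _ x4.
have t2 : 0 < t / 2 by lra.
have [n hn hzx] := hx (t / 2) t2 (Num.bound (r / (t / 2))).
case: (hzw n) => hz hw hd; apply.
have hn' : r / n.+1%:R <= t / 2.
  rewrite ler_pdivrMr ?ltr0n// mulrC -ler_pdivrMr//.
  rewrite (le_trans (ltW (archi_boundP (divr_ge0 (ltW r0) (ltW t2)))))//.
  by rewrite ler_nat (leq_trans hn).
have {hn'}hd := le_trans hd hn'.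
have zt : nm ((zw n).1 - x) < t by lra.
have wt : nm ((zw n).2 - x) < t.
  have := nm_triangle (zw n).2 (zw n).1 x; rewrite (nm_distC (zw n).2 (zw n).1); lra.
have Fz := ht _ zt; have Fw := ht _ wt.
have w0 : F (zw n).2 != 0 by exact: F0.
rewrite (_ : _ - 1 = (F (zw n).1 - F (zw n).2) / F (zw n).2); last by field.
have wn : 0 < nm (F (zw n).2) by rewrite nm_gt0.
rewrite nmM nmV ltr_pdivrMr// mul1r.
have := nm_triangle (F (zw n).1) (F x) (F (zw n).2).
have := nm_subr (F (zw n).2) (F x).
rewrite (nm_distC (F x) (F (zw n).2)); lra.
Qed.

(** Add the principal logarithms of the ratios of [F] at consecutive points of a
    fine subdivision of the radius: these ratios are close to [1], and the real parts
    and the derivatives of their logarithms telescope. *)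
Lemma log_disc (R : realType) (F dF : R[i] -> R[i]) (r : R) : 0 < r ->
  (forall z, nm z <= r -> cderiv F z (dF z)) ->
  (forall z, nm z <= r -> F z != 0) ->
  exists P : R[i] -> R[i], forall z, nm z <= r ->
    cderiv P z (dF z / F z) /\ Re (P z) = ln (nm (F z)).
Proof.
move=> r0 hF F0.
have [|N hN] := uniform_ratio r0 _ F0.
  by move=> z hz; exact: cderiv_cont (hF z hz).
have N0 : (0 : R) < N.+1%:R by rewrite ltr0n.
pose c k : R[i] := (k%:R / N.+1%:R : R)%:C.
have cr k z : (k <= N.+1)%N -> nm z <= r -> nm (c k * z) <= r.
  move=> hk hz; rewrite nmM nm_real ger0_norm ?divr_ge0//.
  rewrite (le_trans _ hz)// ler_piMl ?nm_ge0// ler_pdivrMr// mul1r.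
  by rewrite ler_nat.
suff H k : (k <= N.+1)%N -> exists P : R[i] -> R[i], forall z, nm z <= r ->
    cderiv P z (c k * dF (c k * z) / F (c k * z)) /\
    Re (P z) = ln (nm (F (c k * z))).
  have [P hP] := H _ (leqnn _); exists P => z hz.
  by have := hP z hz; rewrite /c divff ?gt_eqF//= !mul1r.
elim: k => [_|k IH hk].
  exists (fun=> (ln (nm (F 0)))%:C) => z hz.
  by rewrite /c mul0r !mul0r/=; split=> //; exact: cderiv_cst.
have [P hP] := IH (ltnW hk).
exists (fun z => P z + clog (F (c k.+1 * z) / F (c k * z))) => z hz.
have [h1 h2] := hP z hz.
have z1 := cr k z (ltnW hk) hz; have z2 := cr k.+1 z hk hz.
have q0 := F0 _ z1; have q1 := F0 _ z2.
set w := F (c k.+1 * z) / F (c k * z).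
have Rw : 0 < Re w.
  have : nm (w - 1) < 1.
    apply: hN => //; rewrite -mulrBl -rmorphB -mulrBl -natrB// subSnn.
    by rewrite nmM nm_real ger0_norm ?divr_ge0// mulrC mul1r ler_wpM2r// invr_ge0 ltW.
  have := Re_le_nm (w - 1); rewrite raddfB/= ler_norml => /andP[k1 _]; lra.
split; last first.
  rewrite raddfD/= h2 /w nmM nmV ln_div ?posrE ?nm_gt0//.
  by rewrite addrC subrK.
have hd1 : cderiv (fun z => F (c k * z)) z (c k * dF (c k * z)).
  have := @cderiv_affine R F 0 (c k) z (dF (c k * z)); rewrite add0r => /(_ (hF _ z1)).
  by apply: cderiv_ext => v; rewrite add0r.
have hd2 : cderiv (fun z => F (c k.+1 * z)) z (c k.+1 * dF (c k.+1 * z)).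
  have := @cderiv_affine R F 0 (c k.+1) z (dF (c k.+1 * z)); rewrite add0r => /(_ (hF _ z2)).
  by apply: cderiv_ext => v; rewrite add0r.
have := cderivD h1 (cderiv_comp (cderivM hd2 (cderivV q0 hd1)) (cderiv_clog Rw)).
congr cderiv; rewrite /w; field; rewrite q0 q1.
by rewrite -(natrD _ 1) pnatr_eq0.
Qed.

Lemma half_plane_le (R : realType) (p q : R[i]) : 0 < Re p -> 0 < Re q ->
  nm (q - p) <= nm (q + conjc p) /\ 0 < nm (q + conjc p).
Proof.
case: p q => a b [x y] a0 x0.
rewrite /= in a0; rewrite /= in x0; split; last first.
  rewrite nm_gt0; apply/eqP => /(congr1 (@complex.Re R)); simpc => /= h; lra.
rewrite -(ler_pXn2r (_ : 0 < 2)%N)// ?nnegrE ?nm_ge0// !nm_sqr; simpc => /=.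
have := mulr_gt0 a0 x0; nra.
Qed.

(** If [log |F|] is positive on a disc it is the real part of some [P], and
    [(P - P 0) / (P + conj (P 0))] maps the disc into the unit disc; the Cauchy
    estimate at the centre is the assertion. *)
Lemma log_gradient (R : realType) (F dF : R[i] -> R[i]) (r : R) : 0 < r ->
  (forall z, nm z <= r -> cderiv F z (dF z)) ->
  (forall z, nm z <= r -> 1 < nm (F z)) ->
  nm (dF 0 / F 0) <= 2 * ln (nm (F 0)) / r.
Proof.
move=> r0 hF F1.
have [|P hP] := log_disc r0 hF.
  by move=> z /F1 h; rewrite -nm_gt0; lra.
have P0 z : nm z <= r -> 0 < Re (P z).
  by move=> hz; rewrite (hP z hz).2 ln_gt0// F1.
have z0 : nm (0 : R[i]) <= r by rewrite nm0 ltW.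
have [dP rP] := hP 0 z0.
pose phi z := (P z - P 0) / (P z + conjc (P 0)).
have hs z : nm z <= r -> P z + conjc (P 0) != 0.
  by move=> hz; rewrite -nm_gt0; exact: (half_plane_le (P0 _ z0) (P0 _ hz)).2.
have s0 := hs 0 z0.
have hphi z d : nm z <= r -> cderiv P z d ->
    cderiv phi z (d * (P z + conjc (P 0))^-1 +
      (P z - P 0) * (- d / (P z + conjc (P 0)) ^+ 2)).
  move=> hz hd; apply: cderivM.
    by rewrite -[X in cderiv _ _ X]subr0; apply: cderivB => //; exact: cderiv_cst.
  apply: cderivV; first exact: hs.
  by rewrite -[X in cderiv _ _ X]addr0; apply: cderivD => //; exact: cderiv_cst.
have H : nm (dF 0 / F 0 / (P 0 + conjc (P 0))) <= 1 / r.
  have := hphi 0 _ z0 dP; rewrite subrr mul0r addr0 => h.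
  apply: (cauchy_estimate r0 h) => w; rewrite subr0 => hw.
    by eexists; apply: hphi => //; exact: (hP w hw).1.
  rewrite {2}/phi subrr mul0r subr0 /phi nmM nmV.
  have hw' : nm w <= r by rewrite hw.
  have [k1 k2] := half_plane_le (P0 _ z0) (P0 _ hw').
  by rewrite ler_pdivrMr// mul1r.
have nn : nm (P 0 + conjc (P 0)) = 2 * ln (nm (F 0)).
  by rewrite addcJ nmM -rP nm_real nm_nat gtr0_norm ?P0.
move: H; rewrite nmM nmV nn ler_pdivrMr; last by rewrite mulr_gt0// -rP P0.
by rewrite mul1r (mulrC r^-1).
Qed.

Lemma ReMr (R : realType) (w : R[i]) (x : R) : Re (w * x%:C) = Re w * x.
Proof. by case: w => a b; simpc. Qed.

(** [log_gradient] at a point other than the centre, by means of the disc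
    automorphism that moves the centre there. *)
Lemma log_gradient_moebius (R : realType) (F dF : R[i] -> R[i]) (t : R) :
  0 <= t < 1 ->
  (forall z, nm z < 1 -> cderiv F z (dF z)) ->
  (forall z, nm z < 1 -> 1 < nm (F z)) ->
  nm (dF t%:C / F t%:C) * (1 - t ^+ 2) <= 2 * ln (nm (F t%:C)).
Proof.
move=> /andP[t0 t1] hF F1.
pose T (z : R[i]) := (z + t%:C) * (1 + t%:C * z)^-1.
have TT (z : R[i]) : nm z < 1 -> nm (z + t%:C) < nm (1 + t%:C * z).
  move=> z1; rewrite -(ltr_pXn2r (_ : 0 < 2)%N)// ?nnegrE ?nm_ge0// !nm_sqr.
  have : nm z ^+ 2 < 1 by rewrite exprn_ilt1 ?nm_ge0.
  rewrite nm_sqr; case: z z1 => x y _; simpc => /= h.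
  have t2 : 0 < 1 - t ^+ 2 by rewrite subr_gt0 exprn_ilt1.
  by have := mulr_gt0 t2 (_ : 0 < 1 - (x ^+ 2 + y ^+ 2)); rewrite subr_gt0 => /(_ h); nra.
have T0 z : nm z < 1 -> 1 + t%:C * z != 0.
  by move=> z1; rewrite -nm_gt0; exact: le_lt_trans (nm_ge0 _) (TT z z1).
have T1 z : nm z < 1 -> nm (T z) < 1.
  move=> z1; rewrite nmM nmV ltr_pdivrMr ?mul1r ?TT//.
  by rewrite nm_gt0 T0.
pose dT (z : R[i]) := 1 * (1 + t%:C * z)^-1
  + (z + t%:C) * (- t%:C / (1 + t%:C * z) ^+ 2).
have hT z : nm z < 1 -> cderiv T z (dT z).
  move=> z1; apply: cderivM.
    by have := cderivD (cderiv_id z) (cderiv_cst t%:C z); rewrite addr0.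
  apply: cderivV; first exact: T0.
  have := cderivD (cderiv_cst 1 z) (cderivZ t%:C (cderiv_id z)).
  by rewrite mulr1 add0r.
have T00 : T 0 = t%:C by rewrite /T mulr0 addr0 invr1 mulr1 add0r.
have dT0 : dT 0 = (1 - t ^+ 2)%:C.
  by rewrite /dT mulr0 addr0 expr1n invr1 !mulr1 add0r rmorphB rmorphXn rmorph1; ring.
have b0 : 0 <= ln (nm (F t%:C)).
  by apply/ln_ge0/ltW/F1; rewrite nm_real ger0_norm.
have key r : 0 < r < 1 ->
    r * (nm (dF t%:C / F t%:C) * (1 - t ^+ 2)) <= 2 * ln (nm (F t%:C)).
  move=> /andP[r0 r1].
  have := @log_gradient R (fun z => F (T z)) (fun z => dF (T z) * dT z) r r0.
  rewrite T00 dT0; have -> : nm (dF t%:C * (1 - t ^+ 2)%:C / F t%:C) =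
      nm (dF t%:C / F t%:C) * (1 - t ^+ 2).
    by rewrite mulrAC [LHS]nmM nm_real ger0_norm// subr_ge0 exprn_ile1//; exact: ltW.
  move=> h; rewrite mulrC -ler_pdivlMr//; apply: h => z hz.
    apply: cderiv_comp; first by apply: hT; exact: le_lt_trans r1.
    by apply: hF; apply: T1; exact: le_lt_trans r1.
  by apply: F1; apply: T1; exact: le_lt_trans r1.
set a := nm _ * _ in key *; set b := 2 * _ in key *.
rewrite leNgt; apply/negP => ab.
have b0' : 0 <= b by rewrite mulr_ge0.
have a0 : 0 < a by lra.
have := key ((b + a) / 2 / a); rewrite divfK ?gt_eqF//.
rewrite ltr_pdivrMr// mul1r divr_gt0/=; [|lra|exact: a0].
by have -> : (b + a) / 2 < a by [lra|]; move=> /(_ isT); lra.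
Qed.

(** By [log_gradient_moebius] the function [log |F s| * (1 + s) / (1 - s)] of the real
    variable [s] is nondecreasing. *)
Lemma harnack_unit (R : realType) (F dF : R[i] -> R[i]) (t : R) :
  0 <= t < 1 ->
  (forall z, nm z < 1 -> cderiv F z (dF z)) ->
  (forall z, nm z < 1 -> 1 < nm (F z)) ->
  ln (nm (F 0)) * (1 - t) <= ln (nm (F t%:C)) * (1 + t).
Proof.
move=> /andP[t0 t1] hF F1.
have [->|tn0] := eqVneq t 0; first by rewrite addr0 subr0.
have tp : 0 < t by rewrite lt_def tn0.
have lt1 z : nm z <= t -> nm z < 1 by move/le_lt_trans; apply.
have [||P hP] := @log_disc R F dF t tp.
- by move=> z /lt1; exact: hF.
- by move=> z /lt1/F1 h; rewrite -nm_gt0; lra.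
pose Q z := P z * ((1 + z) * (1 - z)^-1).
pose g (s : R) := Re (Q (0 + s%:C * 1)).
pose dg (s : R) := Re (dF s%:C / F s%:C) * ((1 + s) / (1 - s))
  + Re (P s%:C) * (2 / (1 - s) ^+ 2).
have hg (s : R) : 0 <= s <= t -> is_derive s 1 g (dg s).
  move=> /andP[s0 st]; have nms : nm (s%:C : R[i]) <= t by rewrite nm_real ger0_norm.
  have s1 : 1 - s != 0 by rewrite subr_eq0 gt_eqF//; exact: le_lt_trans t1.
  have s1' : 1 - s%:C != 0 :> R[i].
    by rewrite -(rmorph1 (real_complex R)) -rmorphB fmorph_eq0.
  pose d := (dF s%:C / F s%:C) * ((1 + s) / (1 - s))%:C + P s%:C * (2 / (1 - s) ^+ 2)%:C.
  have -> : dg s = Re (d * 1) by rewrite /dg mulr1 raddfD/= !ReMr.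
  apply: is_derive_Re_line; rewrite add0r mulr1 /d.
  have d1 := cderivB (cderiv_cst 1 s%:C) (cderiv_id s%:C).
  have d2 := @cderivV R (fun w => 1 - w) _ _ s1' d1.
  have d3 := cderivM (cderivD (cderiv_cst 1 s%:C) (cderiv_id s%:C)) d2.
  have := cderivM (hP _ nms).1 d3.
  congr cderiv; rewrite !rmorphM !fmorphV !rmorphXn !rmorphB !rmorphD !rmorph1/=.
  by field; rewrite s1' -nm_gt0 (lt_trans ltr01)// F1// lt1.
have [| |s] := @MVT R g dg 0 t tp.
- by move=> s; rewrite in_itv/= => /andP[s0 s1]; apply: hg; rewrite !ltW.
- apply: continuous_in_subspaceT => s; rewrite inE/= in_itv/= => st.
  apply: differentiable_continuous; apply/derivable1_diffP.
  by have := hg s st => -[].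
rewrite in_itv/= => /andP[s0 st]; rewrite subr0 => e.
have dg0 : 0 <= dg s.
  have s1 : s < 1 by exact: lt_trans t1.
  have nms : nm (s%:C : R[i]) <= t by rewrite nm_real ger0_norm// ltW.
  have := @log_gradient_moebius R F dF s; rewrite s1 ltW// => /(_ isT hF F1).
  have := Re_le_nm (dF s%:C / F s%:C).
  rewrite /dg (hP _ nms).2 ler_norml => /andP[h1 _].
  set L := ln _; set n := nm _ in h1 *; set D := Re _ in h1 * => h2.
  have -> : D * ((1 + s) / (1 - s)) + L * (2 / (1 - s) ^+ 2) =
      (D * (1 - s ^+ 2) + 2 * L) / (1 - s) ^+ 2.
    by field; rewrite subr_eq0 gt_eqF.
  have s2 : 0 < 1 - s ^+ 2 by rewrite subr_gt0 exprn_ilt1 ?ltW.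
  rewrite divr_ge0 ?sqr_ge0//; have : - n * (1 - s ^+ 2) <= D * (1 - s ^+ 2).
    by rewrite ler_pM2r.
  by rewrite mulNr; lra.
have : g 0 <= g t by rewrite -subr_ge0 e mulr_ge0// ltW.
rewrite /g !add0r !mulr1 /Q.
have -> : (1 + (0 : R)%:C) * (1 - (0 : R)%:C)^-1 = (1 : R)%:C :> R[i].
  by rewrite addr0 subr0 invr1 mulr1.
have -> : (1 + t%:C) * (1 - t%:C)^-1 = ((1 + t) / (1 - t))%:C :> R[i].
  by rewrite rmorphM fmorphV rmorphB rmorphD rmorph1.
rewrite !ReMr mulr1 (hP _ _).2 ?nm_real ?normr0// (hP _ _).2 ?nm_real ?ger0_norm//.
by rewrite mulrA ler_pdivlMr// subr_gt0.
Qed.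

Lemma harnack (R : realType) (f f1 : R[i] -> R[i]) (x v : R[i]) (t : R) :
  0 <= t < 1 -> v != 0 ->
  (forall z, nm (z - x) < nm v -> cderiv f z (f1 z) /\ 1 < nm (f z)) ->
  ln (nm (f x)) * (1 - t) <= ln (nm (f (x + t%:C * v))) * (1 + t).
Proof.
move=> t01 v0 hf.
have hz z : nm z < 1 -> nm (x + v * z - x) < nm v.
  by move=> z1; rewrite addrAC subrr add0r nmM gtr_pMr// nm_gt0.
have := @harnack_unit R (fun z => f (x + v * z)) (fun z => v * f1 (x + v * z)) t t01.
rewrite mulr0 addr0 (mulrC v t%:C); apply => z /hz/hf[] // hd _.
exact: cderiv_affine.
Qed.

(** Hopf's boundary lemma.  Harnack's lower bound for [log |f|] is linear in the
    distance to a boundary point where [log |f|] vanishes, so the derivative there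
    cannot be small. *)
Lemma hopf (R : realType) (f f1 : R[i] -> R[i]) (x v : R[i]) :
  v != 0 ->
  (forall z, nm (z - x) < nm v -> cderiv f z (f1 z) /\ 1 < nm (f z)) ->
  cderiv f (x + v) (f1 (x + v)) -> nm (f (x + v)) = 1 ->
  ln (nm (f x)) <= 2 * nm v * nm (f1 (x + v)).
Proof.
move=> v0 hf hd h1; have nv : 0 < nm v by rewrite nm_gt0.
set D := nm (f1 _).
have D0 : 0 <= D by exact: nm_ge0.
apply/ler_addgt0Pr => e e0.
have e' : 0 < e / (2 * nm v) by rewrite divr_gt0// mulr_gt0.
have [s s0 hs] := hd _ e'.
pose u := Num.min (s / nm v) 1 / 2.
have m0 : 0 < Num.min (s / nm v) 1 by rewrite lt_min divr_gt0// ltr01.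
have u0 : 0 < u by rewrite /u divr_gt0.
have um : u < Num.min (s / nm v) 1 by rewrite /u ltr_pdivrMr// ltr_pMr// ltr1n.
have [us u1] : u * nm v < s /\ u < 1.
  by move: um; rewrite lt_min => /andP[]; rewrite ltr_pdivlMr.
have hl : nm (f (x + (1 - u)%:C * v)) <= 1 + (D + e / (2 * nm v)) * (u * nm v).
  have := hs (- (u%:C * v)); rewrite nmN nmM nm_real gtr0_norm// => /(_ us).
  have -> : x + v + - (u%:C * v) = x + (1 - u)%:C * v.
    by rewrite rmorphB rmorph1; ring.
  set w := f (x + (1 - u)%:C * v) => h.
  have -> : w = (w - f (x + v) - f1 (x + v) * - (u%:C * v)) +
     (f (x + v) + f1 (x + v) * - (u%:C * v)) by ring.
  rewrite (le_trans (nmD _ _))// (le_trans (lerD h (nmD _ _)))//.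
  by rewrite h1 nmM nmN nmM nm_real gtr0_norm// -/D mulrDl; lra.
have t01 : 0 <= 1 - u < 1 by apply/andP; split; lra.
have := harnack t01 v0 hf.
have F1 : 1 < nm (f (x + (1 - u)%:C * v)).
  apply: (hf _ _).2; rewrite addrAC subrr add0r nmM nm_real ger0_norm; last by lra.
  by rewrite gtr_pMl//; lra.
set w := nm (f (x + _)) in hl F1 *.
have hln : ln w <= w - 1.
  by have := @le_ln1Dx R (w - 1); rewrite (addrC 1) subrK; apply; lra.
rewrite opprB (addrC 1 (u - 1)) subrK => h2.
have l0 : 0 <= ln w by apply: ln_ge0; exact: ltW.
have : ln (nm (f x)) * u <= (D + e / (2 * nm v)) * (u * nm v) * 2.
  apply: le_trans h2 _; rewrite ler_pM//; lra.
rewrite (_ : _ * 2 = (2 * nm v * D + e) * u); last by field; rewrite gt_eqF.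
by rewrite ler_pM2r.
Qed.

(** Apply Hopf's lemma on the largest disc about [x] on which [|f| > 1]: its radius
    is at most [nm (y - x)]. *)
Lemma growth_from_level (R : realType) (f f1 : R[i] -> R[i]) (x y : R[i]) (K : R) :
  holo f f1 -> nm (f y) <= 1 ->
  (forall z, nm (z - x) <= nm (y - x) -> nm (f z) = 1 -> nm (f1 z) <= K) ->
  0 <= K -> nm (f x) <= expR (2 * K * nm (y - x)).
Proof.
move=> hf fy hK K0.
have E1 : 1 <= expR (2 * K * nm (y - x)).
  by rewrite -expR0 ler_expR !mulr_ge0 ?nm_ge0.
have [fx|fx] := leP (nm (f x)) 1; first exact: le_trans E1.
pose S := [set r | exists2 z, nm (f z) <= 1 & r = nm (z - x)].
have Sy : S (nm (y - x)) by exists y.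
have Slb : lbound S 0 by move=> _ [z _ ->]; exact: nm_ge0.
have Sinf : has_inf S by split; [exists (nm (y - x))|exists 0].
set d := inf S.
have dy : d <= nm (y - x) by apply: ge_inf => //; exists 0.
have hd z : nm (z - x) < d -> 1 < nm (f z).
  move=> zd; rewrite ltNge; apply/negP => fz.
  have Sz : S (nm (z - x)) by exists z.
  by have := ge_inf Sinf.2 Sz; rewrite -/d; lra.
have /choice[w hw] : forall n : nat, exists w,
    nm (f w) <= 1 /\ nm (w - x) < d + n.+1%:R^-1.
  move=> n; have n0 : (0 : R) < n.+1%:R^-1 by rewrite invr_gt0 ltr0n.
  by have [_ [z fz ->] hz] := inf_adherent n0 Sinf; exists z.
have [|p hp] := @bolzano_weierstrass R w (d + 1 + nm x).
  move=> n; have := (hw n).2; have := nm_subl (w n) x.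
  have : n.+1%:R^-1 <= 1 :> R by rewrite invf_le1 ?ler1n ?ltr0n.
  by set q := _^-1; lra.
have cf z : ccont f z := holo_cont z hf.
have fp : nm (f p) <= 1.
  apply/ler_addgt0Pr => e e0; have [t t0 ht] := cf p e e0.
  have [n _ /ht hn] := hp t t0 0%N.
  by have := (hw n).1; have := nm_subr (f (w n)) (f p); lra.
have dp : nm (p - x) = d.
  apply/le_anti/andP; split; last first.
    by apply: ge_inf; [exists 0|exists p].
  apply/ler_addgt0Pr => e e0; have e2 : 0 < e / 2 by lra.
  have [n hn hp'] := hp _ e2 (Num.bound (e / 2)^-1).
  have := nm_triangle p (w n) x; rewrite (nm_distC p (w n)).
  have := (hw n).2.
  have : n.+1%:R^-1 <= e / 2.
    rewrite -[leRHS]invrK lef_pV2 ?posrE ?ltr0n ?invr_gt0//.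
    have i0 : 0 <= (e / 2)^-1 by rewrite invr_ge0 ltW.
    by rewrite (le_trans (ltW (archi_boundP i0)))// ler_nat ltnW.
  by set q := _^-1; lra.
pose v := p - x.
have v0 : v != 0.
  apply/eqP => /eqP; rewrite subr_eq0 => /eqP px.
  by move: fp; rewrite px leNgt fx.
have xv : x + v = p by rewrite addrC subrK.
have hdisc z : nm (z - x) < nm v -> cderiv f z (f1 z) /\ 1 < nm (f z).
  by rewrite dp => zd; split; [exact: hf|exact: hd].
have fp1 : nm (f p) = 1.
  apply/le_anti; rewrite fp /=; apply/ler_addgt0Pr => e e0.
  have [t t0 ht] := cf p e e0.
  pose u := Num.min (t / nm v) 1 / 2.
  have nv : 0 < nm v by rewrite nm_gt0.
  have m0 : 0 < Num.min (t / nm v) 1 by rewrite lt_min divr_gt0// ltr01.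
  have u0 : 0 < u by rewrite /u divr_gt0.
  have um : u < Num.min (t / nm v) 1 by rewrite /u ltr_pdivrMr// ltr_pMr// ltr1n.
  have [us u1] : u * nm v < t /\ u < 1.
    by move: um; rewrite lt_min => /andP[]; rewrite ltr_pdivlMr.
  have := ht (p - u%:C * v); rewrite addrAC subrr add0r nmN nmM nm_real gtr0_norm//.
  move=> /(_ us); have := nm_subl (f (p - u%:C * v)) (f p).
  have : 1 < nm (f (p - u%:C * v)).
    apply: (hdisc _ _).2; rewrite (_ : _ - x = (1 - u)%:C * v); last first.
      by rewrite rmorphB rmorph1 /v; ring.
    rewrite nmM nm_real ger0_norm; last by lra.
    by rewrite gtr_pMl//; lra.
  lra.
have := hopf v0 hdisc; rewrite xv => /(_ (hf p) fp1).
rewrite dp => h.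
have hKp : nm (f1 p) <= K by apply: hK; rewrite ?dp.
have d0 : 0 <= d by rewrite -dp nm_ge0.
have n0 := nm_ge0 (f1 p).
rewrite -ler_ln ?posrE ?expR_gt0//; last by lra.
rewrite expRK (le_trans h)//.
have : d * nm (f1 p) <= nm (y - x) * K by exact: ler_pM.
lra.
Qed.

(** * Zeros of limits *)

(** Hurwitz's theorem, from Harnack's inequality for [log |s / h n|]: if the
    zero-free functions [h n] tend to [0] at the centre of a disc, then they do so
    in the whole disc. *)
Lemma hurwitz_step (R : realType) (U : set_system nat) (h h1 : nat -> R[i] -> R[i])
    (x v : R[i]) (M t : R) : UltraFilter U -> 0 <= t < 1 ->
  (forall n, holo (h n) (h1 n)) ->
  U [set n | forall z, nm (z - x) < nm v -> h n z != 0 /\ nm (h n z) <= M] ->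
  ulim U (fun n => h n x) 0 -> ulim U (fun n => h n (x + t%:C * v)) 0.
Proof.
move=> UU /andP[t0 t1] hh hU h0; have UF := @ultra_proper _ _ UU.
have [v0|v0] := eqVneq v 0.
  by rewrite v0 mulr0 addr0.
move=> e e0; pose s := `|M| + 1.
have s0 : 0 < s by rewrite /s ltr_wpDl.
pose A := ln (s / e) * ((1 + t) / (1 - t)).
have eA : 0 < s * expR (- A) by rewrite mulr_gt0// expR_gt0.
apply: filterS (filterI hU (h0 _ eA)) => n /= [k1].
rewrite !subr0 => k2.
have xx : nm (x - x) < nm v by rewrite subrr nm0 nm_gt0.
have F1 z : nm (z - x) < nm v -> 1 < nm (s%:C / h n z).
  move=> /k1[z0 zM]; rewrite nmM nmV nm_real gtr0_norm// ltr_pdivlMr ?nm_gt0//.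
  by rewrite mul1r (le_lt_trans zM)// /s (le_lt_trans (ler_norm _))// ltrDl.
have [hx0 _] := k1 x xx.
pose d (z : R[i]) := s%:C * (- h1 n z / h n z ^+ 2).
have hd z : nm (z - x) < nm v ->
    cderiv (fun z => s%:C / h n z) z (d z) /\ 1 < nm (s%:C / h n z).
  move=> zv; split; last exact: F1.
  by apply: cderivZ; apply: cderivV; [exact: (k1 z zv).1|exact: hh].
have t01 : 0 <= t < 1 by rewrite t0.
have := @harnack R (fun z => s%:C / h n z) d x v t t01 v0 hd.
have tv : nm (x + t%:C * v - x) < nm v.
  by rewrite addrAC subrr add0r nmM nm_real ger0_norm// gtr_pMl// nm_gt0.
have [hz0 _] := k1 _ tv.
rewrite !nmM !nmV nm_real gtr0_norm// => H.
have l1 : A < ln (s / nm (h n x)).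
  rewrite -[ltLHS]expRK ltr_ln ?posrE ?expR_gt0 ?divr_gt0 ?nm_gt0//.
  rewrite ltr_pdivlMr ?nm_gt0// mulrC.
  by move: k2; rewrite expRN ltr_pdivlMr ?expR_gt0.
have t1' : 0 < 1 - t by lra.
have t2 : 0 < 1 + t by lra.
have : A * (1 - t) < ln (s / nm (h n (x + t%:C * v))) * (1 + t).
  by apply: lt_le_trans H; rewrite ltr_pM2r.
rewrite /A -mulrA divfK ?gt_eqF// ltr_pM2r// ltr_ln ?posrE ?divr_gt0 ?nm_gt0//.
by rewrite ltr_pM2l// ltf_pV2 ?posrE ?nm_gt0.
Qed.

Definition locally_bounded_family (R : realType) (U : set_system nat)
    (h : nat -> R[i] -> R[i]) :=
  forall r : R, exists M, U [set n | forall z, nm z <= r -> nm (h n z) <= M].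

(** Every point of the disc of radius [r] about [x] lies halfway to a point at
    distance less than [2 * r]. *)
Lemma hurwitz_disc (R : realType) (U : set_system nat) (h h1 : nat -> R[i] -> R[i])
    (l : R[i] -> R[i]) (x : R[i]) (r : R) : UltraFilter U ->
  (forall n, holo (h n) (h1 n)) -> locally_bounded_family U h ->
  (forall z, ulim U (fun n => h n z) (l z)) -> l x = 0 ->
  U [set n | forall z, nm (z - x) < 2 * r -> h n z != 0] ->
  forall z, nm (z - x) < r -> l z = 0.
Proof.
move=> UU hh hb hl lx hU z zr; have UF := @ultra_proper _ _ UU.
have [M hM] := hb (nm x + 2 * r).
have h0 : ulim U (fun n => h n x) 0 by rewrite -lx.
have n2 : nm (2 * (z - x)) = 2 * nm (z - x).
  by rewrite nmM nm_nat.
have half : 0 <= (2^-1 : R) < 1 by lra.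
have hs : U [set n | forall w, nm (w - x) < nm (2 * (z - x)) ->
    h n w != 0 /\ nm (h n w) <= M].
  apply: filterS (filterI hU hM) => n /= [k1 k2] w; rewrite n2 => hw.
  split; first by apply: k1; lra.
  by apply: k2; have := nm_subl w x; lra.
have := hurwitz_step UU half hh hs h0.
have -> : x + (2^-1 : R)%:C * (2 * (z - x)) = z.
  by rewrite fmorphV rmorph_nat mulKf ?pnatr_eq0// addrC subrK.
move=> z0; apply: (@nm_le_eps_eq0 _ _ 2) => e e0.
have [n [/= k1 k2]] := filter_ex (filterI (hl z _ e0) (z0 _ e0)).
rewrite subr0 in k2; have := nm_subr (h n z) (l z); lra.
Qed.

(** The alternative is exhaustive because the ultrafilter contains either the set of
    indices whose function has a zero in the given disc or the complement of this
    set. *)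
Lemma hurwitz_near (R : realType) (U : set_system nat) (h h1 : nat -> R[i] -> R[i])
    (l : R[i] -> R[i]) (x : R[i]) : UltraFilter U ->
  (forall n, holo (h n) (h1 n)) -> locally_bounded_family U h ->
  (forall z, ulim U (fun n => h n z) (l z)) -> l x = 0 ->
  (exists2 r : R, 0 < r & forall z, nm (z - x) < r -> l z = 0) \/
  forall r : R, 0 < r -> U [set n | exists2 z, nm (z - x) < r & h n z = 0].
Proof.
move=> UU hh hb hl lx; apply/or_asboolP; rewrite -implyNb; apply/implyP.
move=> /asboolPn nl; apply/asboolP => r r0.
have [//|hn] := in_ultra_setVsetC [set n | exists2 z, nm (z - x) < r & h n z = 0] UU.
exfalso; apply: nl; exists (r / 2); first by rewrite divr_gt0.
apply: (hurwitz_disc UU hh hb hl lx).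
have UF := @ultra_proper _ _ UU.
apply: filterS hn => n /= hn z zr; apply/eqP => hz; apply: hn; exists z => //.
by rewrite mulrC divfK in zr.
Qed.

(** * Entire functions of exponential type without zeros *)

(** [ln (A * expR (C * (nm z + r)) / nm (G z))] grows like [C * r], so
    [log_gradient] on larger and larger discs bounds the logarithmic
    derivative. *)
Lemma exp_type_log_derivative (R : realType) (G G1 : R[i] -> R[i]) (A C : R) :
  holo G G1 -> (forall z, G z != 0) -> 0 <= C ->
  (forall z, nm (G z) <= A * expR (C * nm z)) ->
  exists c, forall z, G1 z = c * G z.
Proof.
move=> hG G0 C0 hA.
have [G2 hG2] := holo_derivative hG.
pose q z := G1 z * (G z)^-1.
have hq : holo q (fun z => G2 z * (G z)^-1 + G1 z * (- G1 z / G z ^+ 2)).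
  by move=> z; apply: cderivM; [exact: hG2|exact: cderivV].
have A0 : 0 < A.
  have := hA 0; rewrite nm0 mulr0 expR0 mulr1; apply: lt_le_trans.
  by rewrite nm_gt0.
suff bq z : nm (q z) <= 2 * C.
  exists (q 0) => z; rewrite -(liouville hq bq z) /q divfK//.
apply/ler_addgt0Pr => e e0.
pose B := ln (2 * A) + C * nm z - ln (nm (G z)).
pose r := 2 * (`|B| + 1) / e.
have r0 : 0 < r by rewrite divr_gt0// mulr_gt0// ltr_wpDl.
pose S := 2 * A * expR (C * (nm z + r)).
have S0 : 0 < S by rewrite !mulr_gt0// expR_gt0.
have hd w : nm w <= r -> cderiv (fun w => S%:C / G (z + w)) w
    (S%:C * (- G1 (z + w) / G (z + w) ^+ 2)).
  by move=> _; apply: cderivZ; apply: cderivV => //; exact: (@cderiv_shift _ G).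
have h1 w : nm w <= r -> 1 < nm (S%:C / G (z + w)).
  move=> wr; rewrite nmM nmV nm_real gtr0_norm// ltr_pdivlMr ?nm_gt0// mul1r.
  apply: le_lt_trans (hA _) _; rewrite /S -mulrA -[ltLHS]mul1r.
  apply: (@le_lt_trans _ _ (1 * (A * expR (C * (nm z + r))))).
    rewrite !mul1r ler_pM2l// ler_expR ler_wpM2l//.
    by rewrite (le_trans (nmD _ _))// lerD2l.
  by rewrite ltr_pM2r ?ltr1n// mulr_gt0// expR_gt0.
have := log_gradient r0 hd h1; rewrite addr0.
have -> : nm (S%:C * (- G1 z / G z ^+ 2) / (S%:C / G z)) = nm (q z).
  rewrite -[RHS]nmN; congr nm; rewrite /q; field; rewrite G0/=.
  by rewrite fmorph_eq0 gt_eqF.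
have -> : ln (nm (S%:C / G z)) = B + C * r.
  rewrite nmM nmV nm_real gtr0_norm// ln_div ?posrE ?nm_gt0//.
  by rewrite /S lnM ?posrE ?expR_gt0 ?mulr_gt0// expRK /B; ring.
move/le_trans; apply.
rewrite ler_pdivrMr//.
have : (`|B| + 1) * 2 = e * r by rewrite /r; field; rewrite gt_eqF.
by have := ler_norm B; lra.
Qed.

(** [G] is [G 0 * cexp (c * z)], which omits only the value [0] and has the period
    [2 * pi * i / c]. *)
Lemma exp_solution (R : realType) (G G1 : R[i] -> R[i]) (c w : R[i]) :
  holo G G1 -> (forall z, G1 z = c * G z) -> c != 0 -> G 0 != 0 -> w != 0 ->
  exists z, G z = w /\ G (z + 'i * (2 * pi)%:C / c) = w.
Proof.
move=> hG hc c0 G0 w0.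
have GE z : G z = G 0 * cexp (c * z).
  have hE : holo (fun z => G z * cexp (- c * z)) (fun=> 0).
    move=> v; have h2 : cderiv (fun z => cexp (0 + - c * z)) v (- c * cexp (0 + - c * v)).
      by apply: cderiv_affine; exact: cderiv_cexp.
    have := cderivM (hG v) h2; rewrite hc add0r.
    rewrite (_ : _ + _ = 0); last by ring.
    by apply: cderiv_ext => u; rewrite add0r.
  have := holo_const hE (fun=> erefl) z; rewrite mulr0 cexp0 mulr1 => <-.
  by rewrite -mulrA -cexpD mulNr addNr cexp0 mulr1.
have [u hu] : exists u, cexp u = w / G 0.
  by apply: cexp_onto; rewrite mulf_neq0// invr_eq0.
exists (u / c); rewrite (GE (u / c)) (GE (u / c + _)).
have H (y : R[i]) : c * (y / c) = y by rewrite mulrC divfK.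
by rewrite mulrDr !H cexp2pi hu mulrC divfK.
Qed.

(** * The limit function *)

Lemma lbf_derivative (R : realType) (U : set_system nat) (h h1 : nat -> R[i] -> R[i]) :
  UltraFilter U -> (forall n, holo (h n) (h1 n)) ->
  locally_bounded_family U h -> locally_bounded_family U h1.
Proof.
move=> UU hh hb r; have UF := @ultra_proper _ _ UU.
have [M hM] := hb (r + 1); exists (2 * M); apply: filterS hM => n /= hn z zr.
apply: (cauchy_estimate_unit (hh n)) => w wz; apply: hn.
by have := nm_subl w z; lra.
Qed.

Lemma lbf_ulim (R : realType) (U : set_system nat) (h : nat -> R[i] -> R[i]) :
  UltraFilter U -> locally_bounded_family U h ->
  exists l, forall z, ulim U (fun n => h n z) (l z).
Proof.
move=> UU hb; have UF := @ultra_proper _ _ UU.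
suff /choice[l hl] : forall z, exists y, ulim U (fun n => h n z) y by exists l.
move=> z; have [M hM] := hb (nm z); apply: (@ulim_ex _ _ _ M) => //.
by apply: filterS hM => n /= hn; exact: hn.
Qed.

Lemma lbf_equicontinuous (R : realType) (U : set_system nat)
    (h h1 : nat -> R[i] -> R[i]) (x : R[i]) (e : R) :
  UltraFilter U -> (forall n, holo (h n) (h1 n)) -> locally_bounded_family U h ->
  0 < e -> exists2 t : R, 0 < t &
    U [set n | forall z, nm (z - x) < t -> nm (h n z - h n x) < e].
Proof.
move=> UU hh hb e0; have UF := @ultra_proper _ _ UU.
have [M hM] := hb (nm x + 4).
have k0 : 0 < 2 * `|M| + 1 by rewrite ltr_wpDl// mulr_ge0.
exists (Num.min 1 (e / (2 * `|M| + 1))); first by rewrite lt_min ltr01 divr_gt0.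
apply: filterS hM => n /= hn z; rewrite lt_min => /andP[z1].
rewrite ltr_pdivlMr// => z2.
have hM4 w : nm (w - x) <= 4 -> nm (h n w) <= M.
  by move=> wx; apply: hn; have := nm_subl w x; lra.
have x2 : nm (x - x) <= 2 by rewrite subrr nm0.
have := bounded_increment (hh n) hM4 x2 (ltW z1).
rewrite (addrC x) subrK => /le_lt_trans; apply.
apply: le_lt_trans z2; rewrite mulrC ler_wpM2l ?nm_ge0//.
by have := ler_norm M; lra.
Qed.

(** Rescaling leads to a sequence with the properties below.  For its limit [l],
    with derivative [l1]: either [l] is affine, and then at its zero the slope would
    be [a] or [0]; or [l1 - b] has no zeros and exponential type, so that it is a
    nontrivial exponential, and then [l] vanishes at two points where [l1 = a] and
    that differ by a period, although [l] minus [b z] is periodic. *)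
Lemma no_limit (R : realType) (a b : R[i]) (g g1 : nat -> R[i] -> R[i]) (C : R) :
  b != 0 -> a != b -> 0 <= C ->
  (forall n, holo (g n) (g1 n)) ->
  (forall r : R, exists N, forall n, (N <= n)%N -> forall z, nm z <= r ->
     nm (g n z) <= expR (C * (nm z + 3))) ->
  (forall n z, g n z = 0 -> g1 n z = a \/ g1 n z = 0) ->
  (forall n z, g1 n z = a -> g n z = 0) ->
  (forall r : R, exists N, forall n, (N <= n)%N -> forall z, nm z <= r ->
     g1 n z != b) ->
  (forall n, nm a + 1 <= nm (g1 n 0)) -> False.
Proof.
move=> b0 ab C0 hg hexp hz ha hb hlow.
have [U [UU hU]] := free_ultrafilter; have UF := @ultra_proper _ _ UU.
have /choice[g2 hg2] : forall n, exists g2, holo (g1 n) g2.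
  by move=> n; exact: holo_derivative (hg n).
have bg : locally_bounded_family U g.
  move=> r; have [N hN] := hexp r; exists (expR (C * (r + 3))).
  apply: filterS (hU N) => n /= /hN hn z zr; apply: le_trans (hn z zr) _.
  by rewrite ler_expR ler_wpM2l//; lra.
have bg1 := lbf_derivative UU hg bg.
have bg2 := lbf_derivative UU hg2 bg1.
have [l hl] := lbf_ulim UU bg; have [l1 hl1] := lbf_ulim UU bg1.
have [l2 hl2] := lbf_ulim UU bg2.
have Hl : holo l l1 := holo_ulim UU hg bg hl hl1.
have Hl1 : holo l1 l2 := holo_ulim UU hg2 bg1 hl1 hl2.
have lz x : l x = 0 -> l1 x = a \/ l1 x = 0.
  move=> lx; apply: contrapT => /not_orP[n1 n2].
  have [[r r0 hr]|hr] := hurwitz_near UU hg bg hl lx.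
    apply: n2; apply: (cderiv_unique (Hl x)).
    apply: (cderiv_near (f := fun=> 0) r0) (cderiv_cst _ _) => w /hr ->//.
  pose e := Num.min (nm (l1 x - a)) (nm (l1 x)) / 2.
  have m0 : 0 < Num.min (nm (l1 x - a)) (nm (l1 x)).
    by rewrite lt_min !nm_gt0 subr_eq0; apply/andP; split; exact/eqP.
  have e0 : 0 < e by rewrite divr_gt0.
  have [e1 e2] : 2 * e <= nm (l1 x - a) /\ 2 * e <= nm (l1 x).
    by rewrite mulrC divfK//; apply/andP; rewrite -le_min.
  have [t t0 ht] := lbf_equicontinuous x UU hg2 bg1 e0.
  have [n [[/= k1 [z zt gz]] k2]] := filter_ex (filterI (filterI (hl1 x e e0) (hr t t0)) ht).
  have := k2 z zt; case: (hz n z gz) => ->.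
    have := nm_triangle (l1 x) (g1 n x) a.
    by rewrite (nm_distC a) (nm_distC (l1 x) (g1 n x)); lra.
  by rewrite sub0r nmN; have := nm_subr (g1 n x) (l1 x); lra.
have la x : l1 x = a -> l2 x != 0 -> l x = 0.
  move=> lx lx2.
  have hga n : holo (fun z => g1 n z - a) (g2 n).
    move=> z; have := cderivB (hg2 n z) (cderiv_cst a z); rewrite subr0; exact.
  have bga : locally_bounded_family U (fun n z => g1 n z - a).
    move=> r; have [M hM] := bg1 r; exists (M + nm a); apply: filterS hM => n /= hn z zr.
    by rewrite (le_trans (nmB _ _))// lerD2r hn.
  have hla z : ulim U (fun n => g1 n z - a) (l1 z - a).
    by apply: ulimB => //; exact: ulim_cst.
  have lx0 : l1 x - a = 0 by rewrite lx subrr.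
  have [[r r0 hr]|hr] := hurwitz_near UU hga bga hla lx0.
    exfalso; move/eqP: lx2; apply; apply: (cderiv_unique (Hl1 x)).
    apply: (cderiv_near (f := fun=> a) r0) (cderiv_cst _ _) => w /hr /eqP.
    by rewrite subr_eq0 => /eqP.
  apply: (@nm_le_eps_eq0 _ _ 2) => e e0.
  have [t t0 ht] := lbf_equicontinuous x UU hg bg e0.
  have [n [[/= k1 [z zt ga]] k2]] := filter_ex (filterI (filterI (hl x e e0) (hr t t0)) ht).
  move/eqP: ga; rewrite subr_eq0 => /eqP /ha gz; have := k2 z zt; rewrite gz sub0r nmN.
  by have := nm_subr (g n x) (l x); lra.
have low : nm a + 1 <= nm (l1 0).
  apply/ler_addgt0Pr => e e0; have [n /= k1] := filter_ex (hl1 0 e e0).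
  by have := nm_subl (g1 n 0) (l1 0); have := hlow n; lra.
have a1 := nm_ge0 a.
have notcst k : ~ forall z, l1 z = k.
  move=> hk; have k0 : k != 0 by rewrite -nm_gt0 -(hk 0); lra.
  have hD : holo (fun z => l z - k * z) (fun=> 0).
    move=> z; have := cderivB (Hl z) (cderivZ k (cderiv_id z)).
    by rewrite hk mulr1 subrr.
  have := holo_const hD (fun=> erefl) (- l 0 / k).
  rewrite mulr0 subr0 => /eqP; rewrite subr_eq (mulrC k) divfK// subrr => /eqP.
  move/lz; rewrite hk => -[ka|]; last by apply/eqP.
  by have := low; rewrite hk ka; lra.
have noty : forall x, l1 x - b != 0.
  move=> x; apply/eqP => lx; apply: (notcst b) => z.
  have hgb n : holo (fun z => g1 n z - b) (g2 n).
    move=> w; have := cderivB (hg2 n w) (cderiv_cst b w); rewrite subr0; exact.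
  have bgb : locally_bounded_family U (fun n z => g1 n z - b).
    move=> r; have [M hM] := bg1 r; exists (M + nm b); apply: filterS hM => n /= hn w wr.
    by rewrite (le_trans (nmB _ _))// lerD2r hn.
  have hlb w : ulim U (fun n => g1 n w - b) (l1 w - b).
    by apply: ulimB => //; exact: ulim_cst.
  have [N hN] := hb (nm x + 2 * (nm (z - x) + 1)).
  apply/eqP; rewrite -subr_eq0; apply/eqP.
  apply: (@hurwitz_disc _ U _ _ (fun z => l1 z - b) x (nm (z - x) + 1) UU hgb bgb hlb lx);
    last by rewrite ltrDl.
  apply: filterS (hU N) => n /= nN w wx; rewrite subr_eq0; apply: hN => //.
  by have := nm_subl w x; lra.
have HG : holo (fun z => l1 z - b) l2.
  by move=> w; have := cderivB (Hl1 w) (cderiv_cst b w); rewrite subr0; exact.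
have lexp z : nm (l z) <= expR (C * (nm z + 3)).
  have [N hN] := hexp (nm z); apply: ulim_le (hl z) _ => //.
  by apply: filterS (hU N) => n /= /hN; apply.
have [|c hc] := exp_type_log_derivative (A := 2 * expR (C * 4) + nm b) HG noty C0.
  move=> z; rewrite (le_trans (nmB _ _))// mulrDl; apply: lerD.
    rewrite -mulrA -expRD -mulrDr (addrC 4).
    apply: (cauchy_estimate_unit Hl) => w wz; apply: le_trans (lexp w) _.
    by rewrite ler_expR ler_wpM2l//; have := nm_subl w z; lra.
  by rewrite ler_peMr ?nm_ge0// -expR0 ler_expR mulr_ge0 ?nm_ge0.
have [c0|c0] := eqVneq c 0.
  apply: (notcst (l1 0)); apply: (holo_const Hl1) => z.
  by rewrite hc c0 mul0r.
have ab0 : a - b != 0 by rewrite subr_eq0.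
have [z [h1 h2]] := exp_solution HG hc c0 (noty 0) ab0.
set z' := z + _ in h2.
have zero w : l1 w - b = a - b -> l w = 0.
  move=> hw; apply: la; first by move/addIr: hw.
  by rewrite hc hw mulf_neq0.
have hD : holo (fun z => l z - b * z - c^-1 * (l1 z - b)) (fun=> 0).
  move=> w; have := cderivB (cderivB (Hl w) (cderivZ b (cderiv_id w))) (cderivZ c^-1 (HG w)).
  by rewrite hc mulr1 mulKf// subrr.
have := etrans (holo_const hD (fun=> erefl) z') (esym (holo_const hD (fun=> erefl) z)).
rewrite (zero _ h1) (zero _ h2) h1 h2 !sub0r => /addIr/oppr_inj/(mulfI b0).
rewrite /z' -{2}[z]addr0 => /addrI/eqP.
rewrite !mulf_eq0 invr_eq0 (negbTE c0) orbF => /orP[|].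
  by rewrite -nm_eq0 nm_i oner_eq0.
by rewrite fmorph_eq0 mulf_eq0 pnatr_eq0/= gt_eqF// pi_gt0.
Qed.

(** * Rescaling *)

(** Nearly maximize the product of [m] and the distance to the boundary of the unit
    disc about [x0]: where this distance is at least half as large as at the
    maximum point, [m] exceeds its value there by a bounded factor only. *)
Lemma doubling (R : realType) (m : R[i] -> R) (x0 : R[i]) (N : R) :
  (forall z, 0 <= m z) ->
  (forall z, exists K, exists2 t : R, 0 < t & forall w, nm (w - z) < t -> m w <= K) ->
  0 < N -> N <= m x0 ->
  exists2 x, N / 2 <= m x &
    forall z, nm (z - x) <= N / (4 * m x) -> m z <= 4 * m x.
Proof.
move=> m0 hm N0 Nx.
have [K hK] := locally_bounded_disc (nm x0 + 1) hm.
have hK1 z : nm (z - x0) <= 1 -> m z <= K.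
  by move=> zx; apply: hK; have := nm_subl z x0; lra.
pose phi z := m z * (1 - nm (z - x0)).
pose T := [set phi z | z in [set z | nm (z - x0) <= 1]].
have Tx0 : T (m x0) by exists x0; rewrite /= /phi subrr nm0// subr0 mulr1.
have Tub : ubound T K.
  move=> _ [z /= z1 <-]; apply: le_trans (hK1 z z1); rewrite ler_piMr//.
  by have := nm_ge0 (z - x0); lra.
have Tsup : has_sup T by split; [exists (m x0)|exists K].
have NS : N <= sup T by apply: le_trans Nx _; apply: ub_le_sup => //; exists K.
have S2 : 0 < sup T / 2 by lra.
have [_ [x /= x1 <-] hx] := sup_adherent S2 Tsup.
move: hx; rewrite /phi; set u := 1 - _ => hx.
have u1 : u <= 1 by rewrite /u; have := nm_ge0 (x - x0); lra.
have u0 : 0 <= u by rewrite /u; lra.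
have mu : m x * u <= m x by rewrite ler_piMr.
exists x; first by lra.
have mx : 0 < m x by lra.
move=> z; rewrite ler_pdivlMr ?mulr_gt0// => hz.
have zu : nm (z - x) <= u / 2.
  rewrite -(ler_pM2r (_ : 0 < 4 * m x)) ?mulr_gt0//; apply: le_trans hz _; lra.
have zx0 : u / 2 <= 1 - nm (z - x0).
  by have := nm_triangle z x x0; rewrite /u in zu *; lra.
have zS : m z * (1 - nm (z - x0)) <= sup T.
  apply: ub_le_sup; first by exists K.
  by exists z => //=; lra.
have u0' : 0 < u.
  rewrite lt_def u0 andbT; apply/eqP => ue; rewrite ue mulr0 in hx; lra.
have : m z * (u / 2) <= m z * (1 - nm (z - x0)) by rewrite ler_wpM2l.
move=> h; rewrite -(ler_pM2r u0'); lra.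
Qed.

(** The reciprocal of the scale at which the rescaled function
    [g w = F (x + rho * w) / rho] satisfies [|g'| = B * (1 + |g| ^ 2)] at the origin.
    It vanishes where [|F1| <= B]: outside its domain [Num.sqrt] is zero. *)
Definition scale (R : realType) (B : R) (F F1 : R[i] -> R[i]) (z : R[i]) : R :=
  Num.sqrt ((nm (F1 z) - B) / (B * nm (F z) ^+ 2)).

Section Scale.

Context (R : realType) (B : R) (F F1 : R[i] -> R[i]).
Hypotheses (B1 : 1 <= B) (hF : holo F F1) (hz : forall z, F z = 0 -> nm (F1 z) < B).

Let B0 : 0 < B. Proof. exact: lt_le_trans ltr01 B1. Qed.

Let den z : F z != 0 -> 0 < B * nm (F z) ^+ 2.
Proof. by move=> z0; rewrite mulr_gt0// exprn_gt0// nm_gt0. Qed.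

Lemma scale_ge0 z : 0 <= scale B F F1 z.
Proof. exact: sqrtr_ge0. Qed.

Lemma scale_locally_bounded z :
  exists K, exists2 t : R, 0 < t & forall w, nm (w - z) < t -> scale B F F1 w <= K.
Proof.
have [F2 hF2] := holo_derivative hF.
have c0 := holo_cont z hF; have c1 := holo_cont z hF2.
have [z0|z0] := eqVneq (F z) 0.
  have e0 : 0 < B - nm (F1 z) by rewrite subr_gt0 hz.
  have [t t0 ht] := c1 _ e0; exists 0, t => // w /ht h.
  have h' : nm (F1 w) - B <= 0 by have := nm_subl (F1 w) (F1 z); lra.
  by rewrite /scale ler0_sqrtr// mulr_le0_ge0// invr_ge0 mulr_ge0 ?sqr_ge0// ltW.
have n2 : 0 < nm (F z) / 2 by rewrite divr_gt0// nm_gt0.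
have [t t0 ht] := c0 _ n2; have [s s0 hs] := c1 _ ltr01.
exists (Num.sqrt ((nm (F1 z) + 1) / (B * (nm (F z) / 2) ^+ 2))), (Num.min t s).
  by rewrite lt_min t0.
move=> w; rewrite lt_min => /andP[/ht h1 /hs h2].
have Fw : nm (F z) / 2 <= nm (F w) by have := nm_subr (F w) (F z); lra.
have Fw0 : F w != 0 by rewrite -nm_gt0 (lt_le_trans n2).
have d0 : 0 < B * (nm (F z) / 2) ^+ 2 by rewrite mulr_gt0// exprn_gt0.
have p1 := nm_ge0 (F1 z); have b0 := B0.
rewrite ler_wsqrtr// ler_pdivrMr ?den// mulrAC ler_pdivlMr//.
apply: (@le_trans _ _ ((nm (F1 z) + 1) * (B * (nm (F z) / 2) ^+ 2))).
  by rewrite ler_pM2r//; have := nm_subl (F1 w) (F1 z); lra.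
apply: ler_wpM2l; first by lra.
by rewrite ler_pM2l// lerXn2r ?nnegrE ?nm_ge0// ltW.
Qed.

Lemma scale_le z (k : R) : 0 <= k -> scale B F F1 z <= k ->
  nm (F1 z) <= B + B * (k * nm (F z)) ^+ 2.
Proof.
move=> k0 hk; have [h|h] := leP (nm (F1 z)) B.
  by apply: le_trans h _; rewrite lerDl mulr_ge0 ?sqr_ge0 ?ltW.
have z0 : F z != 0.
  by apply/eqP => /hz; rewrite ltNge (ltW h).
have q0 : 0 <= (nm (F1 z) - B) / (B * nm (F z) ^+ 2).
  by rewrite divr_ge0 ?(ltW (den z0))//; lra.
have : (nm (F1 z) - B) / (B * nm (F z) ^+ 2) <= k ^+ 2.
  by rewrite -(sqr_sqrtr q0) lerXn2r ?nnegrE ?sqrtr_ge0.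
by rewrite ler_pdivrMr ?den// exprMn; lra.
Qed.

Lemma scale_eq z : 0 < scale B F F1 z ->
  nm (F1 z) = B + B * (scale B F F1 z * nm (F z)) ^+ 2.
Proof.
rewrite sqrtr_gt0 => q0; rewrite exprMn /scale sqr_sqrtr ?ltW//.
have z0 : F z != 0.
  apply: contraTneq q0 => ->.
  by rewrite nm0 expr0n/= mulr0 invr0 mulr0 ltxx.
by field; rewrite nm_eq0 z0 (gt_eqF B0).
Qed.

Lemma scale_level z (N : R) : 0 <= N -> nm (F z) = 1 -> B + B * N ^+ 2 <= nm (F1 z) ->
  N <= scale B F F1 z.
Proof.
move=> N0 z1 h; rewrite /scale z1 expr1n mulr1 -[leLHS](ger0_norm N0) -sqrtr_sqr.
by rewrite ler_wsqrtr// ler_pdivlMr//; lra.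
Qed.

End Scale.

(** Otherwise rescaling at points where [scale] is large would contradict
    [no_limit].  That the rescaled functions are uniformly of exponential type
    follows from [growth_from_level], once [log_gradient] has provided a point near
    the origin where they are at most [1]. *)
Lemma level_bound (R : realType) (a b : R[i]) (F F1 : R[i] -> R[i]) :
  b != 0 -> a != b -> holo F F1 ->
  (forall z, F z = 0 -> F1 z = a \/ F1 z = 0) ->
  (forall z, F1 z = a -> F z = 0) ->
  (forall z, F1 z = b -> F z = b - a) ->
  exists K, forall z, nm (F z) = 1 -> nm (F1 z) <= K.
Proof.
move=> b0 ab hF h0 ha hb; apply: contrapT => /forallNP unb.
pose B := nm a + 1.
have a0 := nm_ge0 a.
have B1 : 1 <= B by rewrite /B; lra.
have B0 : 0 < B by lra.
have hz z : F z = 0 -> nm (F1 z) < B.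
  by case/h0 => ->; rewrite ?nm0 /B; lra.
pose m := scale B F F1.
have m0 z : 0 <= m z by exact: scale_ge0.
have /choice[x hx] : forall n : nat, exists x, (n.+1%:R : R) / 2 <= m x /\
    forall z, nm (z - x) <= n.+1%:R / (4 * m x) -> m z <= 4 * m x.
  move=> n; have /existsNP[y /not_implyP[y1 /negP]] := unb (B + B * n.+1%:R ^+ 2).
  rewrite -ltNge => hy.
  have [|||x x1 x2] := @doubling R m y n.+1%:R m0 _ _ _.
  - exact: (scale_locally_bounded B1 hF hz).
  - by rewrite ltr0n.
  - by apply: scale_level => //; exact: ltW.
  - by exists x.
have M0 n : 0 < m (x n) by apply: lt_le_trans (hx n).1; rewrite divr_gt0 ?ltr0n.
have Mc n : (m (x n))%:C != 0 :> R[i] by rewrite fmorph_eq0 gt_eqF.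
pose g n z := (m (x n))%:C * F (x n + (m (x n))%:C^-1 * z).
pose g1 n z := F1 (x n + (m (x n))%:C^-1 * z).
have hg n : holo (g n) (g1 n).
  move=> z; have := cderivZ (m (x n))%:C (cderiv_affine (hF (x n + (m (x n))%:C^-1 * z))).
  by rewrite mulVKf.
have ng n z : nm (g n z) = m (x n) * nm (F (x n + (m (x n))%:C^-1 * z)).
  by rewrite nmM nm_real ger0_norm.
have g1_le n z : nm z <= n.+1%:R / 4 -> nm (g1 n z) <= B + B * (4 * nm (g n z)) ^+ 2.
  move=> hzn; rewrite ng /g1 (mulrA 4). apply: (scale_le B1 hz).
    by rewrite mulr_ge0.
  apply: (hx n).2; rewrite addrAC subrr add0r nmM nmV nm_real ger0_norm//.
  by rewrite invfM mulrA mulrC ler_pM2r ?invr_gt0.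
have g1_0 n : nm (g1 n 0) = B + B * nm (g n 0) ^+ 2.
  by rewrite ng /g1 mulr0 addr0; apply: scale_eq.
have near1 n : (16 <= n.+1)%N -> exists2 y, nm y <= 3 & nm (g n y) <= 1.
  move=> n16; apply: contrapT => nex.
  have big y : nm y <= 3 -> 1 < nm (g n y).
    by move=> y3; rewrite ltNge; apply/negP => hy; apply: nex; exists y.
  have r3 : (0 : R) < 3 by [].
  have := log_gradient r3 (fun z _ => hg n z) big.
  have z0 : nm (0 : R[i]) <= 3 by rewrite nm0.
  have := big 0 z0; rewrite nmM nmV g1_0; set y := nm _ => y1.
  have y0 : 0 < y by lra.
  have := @le_ln1Dx R (y - 1); rewrite (addrC 1) subrK => /(_ _) hln.
  have {}hln : ln y <= y - 1 by apply: hln; lra.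
  rewrite ler_pdivrMr//; apply/negP; rewrite -ltNge.
  have : y ^+ 2 <= B * y ^+ 2 by rewrite ler_peMl ?sqr_ge0.
  have : 2 * ln y / 3 * y <= y * y.
    by rewrite ler_pM2r//; lra.
  by rewrite expr2; lra.
have bound n z : (16 <= n.+1)%N -> 2 * nm z + 3 <= n.+1%:R / 4 ->
    nm (g n z) <= expR (34 * B * (nm z + 3)).
  move=> n16 hzn; have [y y3 gy] := near1 n n16.
  have yz : nm (y - z) <= nm z + 3 by have := nmB y z; lra.
  apply: le_trans (growth_from_level (K := 17 * B) (hg n) gy _ _) _.
  - move=> w wz w1; have wn : nm w <= n.+1%:R / 4 by have := nm_subl w z; lra.
    by have := g1_le n w wn; rewrite w1 mulr1; lra.
  - by rewrite mulr_ge0// ltW.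
  - rewrite ler_expR (_ : 2 * (17 * B) = 34 * B); last by ring.
    by rewrite ler_wpM2l// mulr_ge0// ltW.
have bound_ev (r : R) : exists N, forall n, (N <= n)%N -> forall z, nm z <= r ->
    nm (g n z) <= expR (34 * B * (nm z + 3)).
  have [k hk] : exists k : nat, 4 * (2 * r + 3) <= k%:R.
    exists (Num.bound `|4 * (2 * r + 3)|); apply: le_trans (ler_norm _) _.
    by apply/ltW/archi_boundP.
  exists (maxn 16 k) => n; rewrite geq_max => /andP[n16 kn] z zr.
  apply: bound; first exact: leqW.
  rewrite ler_pdivlMr//; apply: (@le_trans _ _ k%:R); first by lra.
  by rewrite ler_nat leqW.
apply: (no_limit (C := 34 * B) b0 ab _ hg bound_ev).
- by rewrite mulr_ge0// ltW.
- move=> n z /eqP; rewrite mulf_eq0 (negbTE (Mc n)) => /eqP; exact: h0.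
- by move=> n z /ha; rewrite /g => ->; rewrite mulr0.
- move=> r; have [N hN] := bound_ev r.
  have d0 : 0 < nm (b - a) by rewrite nm_gt0 subr_eq0 eq_sym.
  pose q := expR (34 * B * (r + 3)) / nm (b - a) * 2.
  exists (maxn N (Num.bound q)) => n; rewrite geq_max => /andP[nN nq] z zr.
  apply/eqP => /hb hFb; have := hN n nN z zr; rewrite ng hFb.
  apply/negP; rewrite -ltNge.
  apply: (@le_lt_trans _ _ (expR (34 * B * (r + 3)))).
    have C0 : 0 <= 34 * B by rewrite mulr_ge0// ltW.
    by rewrite ler_expR ler_wpM2l//; lra.
  rewrite -ltr_pdivrMr//; apply: lt_le_trans (hx n).1.
  rewrite ltr_pdivlMr// -/q.
  have q0 : 0 <= q by rewrite !mulr_ge0 ?invr_ge0 ?expR_ge0 ?nm_ge0.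
  apply: lt_le_trans (archi_boundP q0) _.
  by rewrite ler_nat leqW.
- by move=> n; rewrite g1_0 lerDl mulr_ge0 ?sqr_ge0// ltW.
Qed.

(** By Liouville's theorem for [1 / F] there is a point where [|F| <= 1], from which
    [growth_from_level] starts. *)
Lemma exp_type (R : realType) (F F1 : R[i] -> R[i]) (K : R) :
  holo F F1 -> (forall z, nm (F z) = 1 -> nm (F1 z) <= K) ->
  ~ (forall z, F z = F 0) ->
  exists A C : R, 0 <= C /\ forall z, nm (F z) <= expR (C * (nm z + A)).
Proof.
move=> hF hK nc.
have [y hy] : exists y, nm (F y) <= 1.
  apply: contrapT => /forallNP ny.
  have big z : 1 < nm (F z) by rewrite ltNge; apply/negP; exact: ny.
  have F0 z : F z != 0 by rewrite -nm_gt0; have := big z; lra.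
  apply: nc => z; apply: invr_inj.
  apply: (@liouville R (fun z => (F z)^-1) (fun z => - F1 z / F z ^+ 2) 1).
    by move=> w; exact: cderivV.
  by move=> w; rewrite nmV invf_le1 ?ltW//; have := big w; lra.
exists (nm y), (2 * `|K|); split=> [|z]; first by rewrite mulr_ge0.
apply: le_trans (growth_from_level (K := `|K|) hF hy _ _) _ => //.
  by move=> w _ /hK /le_trans; apply; exact: ler_norm.
by rewrite ler_expR ler_wpM2l ?mulr_ge0// (addrC (nm z)) nmB.
Qed.

(** * The polynomial case *)

Lemma size_lead_deriv (F : numDomainType) (p : {poly F}) : (1 < size p)%N ->
  size p^`() = (size p).-1 /\ lead_coef p^`() = lead_coef p *+ (size p).-1.
Proof.
case sp : (size p) => [//|[//|n]] _ /=.
have pn : p`_n.+1 != 0.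
  have : lead_coef p != 0 by rewrite lead_coef_eq0 -size_poly_eq0 sp.
  by rewrite lead_coefE sp.
have dn : p^`()`_n != 0 by rewrite coef_deriv -mulr_natr mulf_neq0// pnatr_eq0.
have sd : size p^`() = n.+1.
  apply/eqP; rewrite eqn_leq; apply/andP; split.
    by rewrite -ltnS -sp lt_size_deriv// -size_poly_eq0 sp.
  by rewrite ltnNge; apply: contraNN dn => h; rewrite nth_default.
by split=> //; rewrite !lead_coefE sd sp /= coef_deriv.
Qed.

(** Each simple factor of [q] divides the derivative of its cofactor or, by
    hypothesis, [d]. *)
Lemma dvdp_deriv_mul (F : closedFieldType) (q d : {poly F}) : q != 0 ->
  (forall z, root q z -> root d z) -> q %| q^`() * d.
Proof.
have [n] := ubnP (size q); elim: n q => // n IH q qn q0 hq.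
have [/size_poly1P[c c0 ->]|/closed_rootP[x rx]] := boolP (size q == 1)%N.
  by rewrite -[c%:P]mulr1 mul_polyC dvdpZl// dvd1p.
have [q1 qE] := factor_theorem _ _ rx.
have [d1 dE] := factor_theorem _ _ (hq x rx).
have q10 : q1 != 0 by apply: contraNneq q0 => e; rewrite qE e mul0r.
have /dvdpP[u hu] : q1 %| q1^`() * d.
  apply: IH => //; last by move=> z rz; apply: hq; rewrite qE rootM rz.
  by rewrite qE size_Mmonic ?monicXsubC// size_XsubC addn2 in qn.
have -> : q^`() * d = (u + d1) * q; last exact: dvdp_mull.
rewrite {1}qE derivM derivXsubC mulr1 mulrDl (mulrAC _ ('X - _)) hu [in X in _ + X]dE qE.
ring.
Qed.

Lemma dvdp_of_simple_roots (F : closedFieldType) (q d : {poly F}) : q != 0 ->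
  (forall z, root q z -> root d z) -> (forall z, root q z -> ~~ root q^`() z) ->
  q %| d.
Proof.
move=> q0 hd hs; rewrite -(@Gauss_dvdpr _ d q^`()) ?dvdp_deriv_mul//.
exact: Pdiv.ClosedField.root_coprimep.
Qed.

(** Comparison of the leading terms of both sides at a multiple root of [q]. *)
Lemma multiple_root_relation (F : numFieldType) (q d u : {poly F}) (c z : F) :
  q != 0 -> q^`() * d = c *: (q * u) -> root d z -> root q z -> root q^`() z ->
  exists2 k : nat, (2 <= k)%N & k%:R * d^`().[z] = c * u.[z].
Proof.
move=> q0 H rd rq rq'.
have [k [w]] := multiplicity_XsubC q z; rewrite q0 /= => rw qE.
have [d1 dE] := factor_theorem _ _ rd.
have k2 : (2 <= k)%N.
  case: k qE => [|[|//]] qE.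
    by move: rq; rewrite qE expr0 mulr1 (negbTE rw).
  move: rq'; rewrite qE expr1 derivM derivXsubC mulr1 rootE hornerD hornerM.
  by rewrite hornerXsubC subrr mulr0 add0r -rootE (negbTE rw).
exists k => //; case: k k2 qE => // k _ qE.
have X0 : ('X - z%:P) ^+ k.+1 != 0 by rewrite expf_neq0// polyXsubC_eq0.
have : (w^`() * ('X - z%:P) + w *+ k.+1) * d1 = c *: (w * u).
  apply: (mulIf X0); rewrite -scalerAl [w * u]mulrC -(mulrA u) -qE (mulrC u) -H.
  rewrite qE derivM deriv_exp derivXsubC mul1r dE /=.
  by rewrite -(mulr_natr w) -(mulr_natr (_ ^+ k)) exprS; ring.
move/(congr1 (fun p => p.[z])).
rewrite hornerM hornerD hornerM hornerXsubC subrr mulr0 add0r hornerMn.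
rewrite hornerZ hornerM dE derivM derivXsubC mulr1 hornerD hornerM.
rewrite hornerXsubC subrr mulr0 add0r => e.
have w0 : w.[z] != 0 by [].
by apply: (mulfI w0); rewrite [RHS]mulrCA -e -mulr_natl; ring.
Qed.

Lemma add_le_mul (k m : nat) : (2 <= k)%N -> (2 <= m)%N -> (k + m <= k * m)%N.
Proof.
case: k m => [|[|k]] [|[|m]] // _ _; have := @leq_pmulr k m.+2 isT.
by rewrite !mulSn; lia.
Qed.

Lemma leading_ratio (F : fieldType) (r c : F) (n m : nat) :
  r != 0 -> n%:R != 0 :> F -> r *+ n *+ m * r = c * (r *+ n * (r *+ n)) ->
  c * n%:R = m%:R.
Proof.
move=> r0 n0; rewrite -(mulr_natr (r *+ n)) -(mulr_natr r).
move: n%:R m%:R n0 => x y x0 e; have k0 : r * r * x != 0 by rewrite !mulf_neq0.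
have e1 : r * r * x * y = r * x * y * r by ring.
by apply: (mulfI k0); rewrite e1 e; ring.
Qed.

(** With [A = p' - a], [B = p' - b] and [D = p - p'], every root of [A] or [B] is a
    root of [D]; hence [p'' * D = c * A * B], with [c = (n - 1) / n] and [n] the
    degree of [p].  Multiple roots of [A] and of [B], of orders [k] and [m], would give
    [1 / k + 1 / m = 1 / c > 1].  If [A] has simple roots only, then [p - a] is
    the product of [A] and a linear polynomial, whose root contradicts [h1]; if
    [B] has simple roots only, then [p - b] is the product of [B] and a linear
    polynomial, and a multiple root of [A] is impossible. *)
Lemma no_polynomial (F : numClosedFieldType) (p : {poly F}) (a b : F) :
  a != 0 -> b != 0 -> a != b -> (1 < size p)%N ->
  (forall z, p.[z] = a -> p^`().[z] = a \/ p^`().[z] = 0) ->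
  (forall z, p^`().[z] = a -> p.[z] = a) ->
  (forall z, p^`().[z] = b -> p.[z] = b) -> False.
Proof.
move=> a0 b0 ab sp h1 h2 h3.
have [sp' lp'] := size_lead_deriv sp.
have size_sub (q : {poly F}) (c : F) : (1 < size q)%N -> size (q - c%:P) = size q.
  by move=> sq; rewrite size_polyDl// size_polyN (leq_ltn_trans (size_polyC_leq1 _)).
have root_sub (q : {poly F}) (c z : F) : root (q - c%:P) z <-> q.[z] = c.
  rewrite rootE hornerD hornerN hornerC subr_eq0.
  by split=> [/eqP|->].
have pa : size (p - a%:P) != 1%N by rewrite size_sub// gtn_eqF.
have [n1|n1] := leqP (size p^`()) 1.
  have cst z : p^`().[z] = (p^`())`_0 by rewrite (size1_polyC n1) hornerC coefC.
  have l0 : (p^`())`_0 != 0.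
    rewrite -(_ : lead_coef p^`() = p^`()`_0); last first.
      by rewrite lead_coefE; case: (size _) n1 => [|[]].
    by rewrite lead_coef_eq0 -size_poly_eq0 sp' -lt0n -ltnS prednK// (ltn_trans _ sp).
  have [z /root_sub /h1] := closed_rootP _ pa; rewrite cst => -[e|e]; last first.
    by rewrite e eqxx in l0.
  have pa1 : size (p - (a + 1)%:P) != 1%N by rewrite size_sub// gtn_eqF.
  have [w /root_sub hw] := closed_rootP _ pa1.
  have := h2 w; rewrite cst hw => /(_ e)/eqP.
  by rewrite -subr_eq0 addrAC subrr add0r oner_eq0.
pose A := p^`() - a%:P; pose B := p^`() - b%:P; pose D := p - p^`().
have [sA sB] : size A = size p^`() /\ size B = size p^`() by rewrite !size_sub.
have A0 : A != 0 by rewrite -size_poly_gt0 sA (ltn_trans _ n1).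
have B0 : B != 0 by rewrite -size_poly_gt0 sB (ltn_trans _ n1).
have dA : A^`() = p^`()^`() by rewrite derivB derivC subr0.
have dB : B^`() = p^`()^`() by rewrite derivB derivC subr0.
have rAD z : root A z -> root D z.
  move=> /root_sub hz; rewrite rootE hornerD hornerN (h2 z hz) hz subrr//.
have rBD z : root B z -> root D z.
  move=> /root_sub hz; rewrite rootE hornerD hornerN (h3 z hz) hz subrr//.
have cAB : coprimep A B.
  apply: Pdiv.ClosedField.root_coprimep => z /root_sub hz.
  by rewrite hornerD hornerN hornerC hz subr_eq0.
have [sp'' lp''] := size_lead_deriv n1.
have ltd : (size (- p^`())%R < size p)%N by rewrite size_polyN sp' prednK// (ltn_trans _ sp).
have lD : lead_coef D = lead_coef p by rewrite /D lead_coefDl.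
have sD : size D = size p by rewrite /D size_polyDl.
have D0 : D != 0 by rewrite -size_poly_gt0 sD (ltn_trans _ sp).
have p''0 : p^`()^`() != 0.
  by rewrite -size_poly_gt0 sp'' -ltnS prednK// (ltn_trans _ n1).
have [q hq] : exists q, p^`()^`() * D = q * (A * B).
  apply/dvdpP; rewrite Gauss_dvdp// -{1}dA -dB.
  by rewrite !dvdp_deriv_mul.
have q0 : q != 0.
  by apply: contraNneq (mulf_neq0 p''0 D0) => e; rewrite hq e mul0r.
have [c cE] : exists c, q = c%:P.
  have : size (p^`()^`() * D) = size (q * (A * B)) by rewrite hq.
  rewrite !size_mul ?mulf_neq0// sA sB sp'' sD => e.
  exists q`_0; apply: size1_polyC; move: e n1.
  by rewrite sp'; move: (size p) (size q) sp => x y; clear; lia.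
set n := (size p).-1 in lp' sp' sp''.
have n2 : (2 <= n)%N by rewrite -sp'.
have lp0 : lead_coef p != 0 by rewrite lead_coef_eq0 -size_poly_gt0 (ltn_trans _ sp).
have nF : n%:R != 0 :> F by rewrite pnatr_eq0 -lt0n (ltn_trans _ n2).
have lAB : lead_coef A = lead_coef p^`() /\ lead_coef B = lead_coef p^`().
  by split; rewrite lead_coefDl// size_polyN (leq_ltn_trans (size_polyC_leq1 _)).
have cn : c * n%:R = n.-1%:R.
  have := congr1 lead_coef hq; rewrite cE !lead_coefM lead_coefC lAB.1 lAB.2 lp'' lD lp' sp'.
  exact: leading_ratio.
have HA : A^`() * D = c *: (A * B) by rewrite dA hq cE mul_polyC.
have HB : B^`() * D = c *: (B * A) by rewrite dB hq cE mul_polyC mulrC.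
have dD z : D^`().[z] = p^`().[z] - p^`()^`().[z].
  by rewrite /D derivB hornerD hornerN.
have cofactor e (q' := p^`() - e%:P) : (forall z, root q' z -> p.[z] = e) ->
    (forall z, root q' z -> ~~ root q'^`() z) ->
    exists2 l : {poly F}, p - e%:P = l * q' & exists v w : F, [/\ l.[v] = 0, w != 0 &
      forall z, l^`().[z] = w].
  move=> hr hs; have sq' : size q' = size p^`() by rewrite size_sub.
  have q'0 : q' != 0 by rewrite -size_poly_gt0 sq' (ltn_trans _ n1).
  have /dvdpP[l hl] : q' %| p - e%:P.
    by apply: dvdp_of_simple_roots => // z /hr hz; apply/root_sub.
  have l0 : l != 0.
    have pe0 : p - e%:P != 0 by rewrite -size_poly_gt0 size_sub// (ltn_trans _ sp).
    by apply: contraNneq pe0 => e0; rewrite hl e0 mul0r.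
  have sl : size l = 2.
    have := congr1 (fun q : {poly F} => size q) hl; rewrite size_sub// size_mul// sq' sp'.
    by rewrite /n; move: (size p) (size l) sp => x y; clear; lia.
  exists l => //.
  have [v /rootP hv] : exists v, root l v by apply/closed_rootP; rewrite sl.
  have [|sl' ll'] := size_lead_deriv (p := l); first by rewrite sl.
  have sl1 : (size l^`() <= 1)%N by rewrite sl' sl.
  exists v, (l^`())`_0; split=> //.
    rewrite (_ : l^`()`_0 = lead_coef l^`()); last by rewrite lead_coefE sl' sl.
    by rewrite ll' sl mulr1n lead_coef_eq0.
  by move=> z; rewrite {1}(size1_polyC sl1) hornerC.
have [sqA|] := pselect (forall z, root A z -> ~~ root A^`() z).
  have [z|l hl [v [w [lv w0 lw]]]] := cofactor a _ sqA.
    by move=> /root_sub; exact: h2.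
  have pv : p.[v] = a.
    by apply/root_sub; rewrite hl rootM rootE lv eqxx.
  have : p^`().[v] = w * A.[v].
    have := congr1 (fun q : {poly F} => q^`().[v]) hl.
    rewrite derivB derivC subr0 derivM hornerD !hornerM lv mul0r addr0 lw; exact.
  rewrite hornerD hornerN hornerC; case: (h1 v pv) => ->.
    by rewrite subrr mulr0 => /eqP; rewrite (negbTE a0).
  by rewrite sub0r mulrN => /esym/eqP; rewrite oppr_eq0 mulf_eq0 (negbTE w0) (negbTE a0).
move=> /existsNP[z /not_implyP[rz /negP/negPn rz']].
have pz : p^`().[z] = a by apply/root_sub.
have pz'' : p^`()^`().[z] = 0 by apply/rootP; rewrite -dA.
have [k k2] := multiple_root_relation A0 HA (rAD z rz) rz rz'.
rewrite dD pz pz'' subr0 hornerD hornerN hornerC pz => ka.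
have [sqB|] := pselect (forall z, root B z -> ~~ root B^`() z).
  have [y|l hl [v [w [lv w0 lw]]]] := cofactor b _ sqB.
    by move=> /root_sub; exact: h3.
  have dp y : p^`().[y] = w * (p^`().[y] - b) + l.[y] * p^`()^`().[y].
    have := congr1 (fun q : {poly F} => q^`().[y]) hl.
    rewrite derivB derivC subr0 derivM derivB derivC subr0 hornerD !hornerM lw.
    by rewrite hornerD hornerN hornerC; exact.
  have e1 := dp z; rewrite pz pz'' mulr0 addr0 in e1.
  have e2 := dp v; rewrite lv mul0r addr0 in e2.
  have w1 : w != 1.
    apply: contra_neq b0 => w1; move: e1; rewrite w1 mul1r => e1.
    by rewrite -[b]opprK (_ : - b = 0) ?oppr0//; apply: (addrI a); rewrite -e1 addr0.
  have pv : p^`().[v] = a.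
    have w1' : 1 - w != 0 by rewrite subr_eq0 eq_sym.
    apply: (mulfI w1'); rewrite !mulrBl !mul1r {1}e1 {1}e2; ring.
  have : (p - b%:P).[v] = 0 by rewrite hl hornerM lv mul0r.
  rewrite hornerD hornerN hornerC (h2 v pv) => /eqP.
  by rewrite subr_eq0 (negbTE ab).
move=> /existsNP[y /not_implyP[ry /negP/negPn ry']].
have py : p^`().[y] = b by apply/root_sub.
have py'' : p^`()^`().[y] = 0 by apply/rootP; rewrite -dB.
have [m m2] := multiple_root_relation B0 HB (rBD y ry) ry ry'.
rewrite dD py py'' subr0 hornerD hornerN hornerC py => mb.
have : (n * (k * m))%:R = (n.-1 * (k + m))%:R :> F.
  have ab0 : a - b != 0 by rewrite subr_eq0.
  apply: (mulfI ab0); rewrite !natrM natrD -cn.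
  have -> : (a - b) * (n%:R * (k%:R * m%:R)) =
      n%:R * (m%:R * (k%:R * a) - k%:R * (m%:R * b)) by ring.
  by rewrite ka mb; ring.
move/eqP; rewrite eqr_nat => /eqP e.
have km := add_le_mul k2 m2.
have : (n * (k + m) <= n * (k * m))%N by rewrite leq_mul2l km orbT.
have n0 : (0 < n)%N := ltnW n2.
rewrite e leq_pmul2r; last by rewrite addn_gt0 (ltnW k2).
by rewrite leqNgt ltn_predL n0.
Qed.

(** * The theorem *)

Lemma nm_normE (R : realType) (z : R[i]) : `|z| = (nm z)%:C.
Proof. by rewrite normc_def nmE. Qed.

Lemma entire_holo (R : realType) (f : R[i]^o -> R[i]^o) : entire f -> holo f (derive1 f).
Proof.
move=> hf z e e0; have := hf z; rewrite /derivable => df.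
pose g (h : R[i]^o) : R[i]^o := h^-1 *: ((f \o shift z) (h *: (1 : R[i]^o)) - f z).
have : g @ (0 : R[i]^o)^' --> derive1 f z by rewrite derive1E.
have e0' : (0 : R[i]) < e%:C by rewrite ltcR.
move=> /cvgrPdist_le/(_ _ e0') /nbhs_ballP[t t0 ht].
have tE : t = (Re t)%:C.
  by case: t t0 {ht} => x y; rewrite /= ltcE/= => /andP[/eqP -> _].
have t0' : 0 < Re t by move: t0; rewrite /= ltcE => /andP[].
exists (Re t) => // h hh; have [->|h0] := eqVneq h 0.
  by rewrite addr0 subrr mulr0 subrr nm0 mulr0.
have := ht h; rewrite -ball_normE/= sub0r normrN nm_normE tE ltcR => /(_ hh h0).
rewrite /= nm_normE lecR /g /shift /= [h *: 1]mulr1 => H.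
rewrite (_ : f (z + h) - f z - derive1 f z * h =
  - ((derive1 f z - h^-1 *: (f (h + z) - f z)) * h)); last first.
  by rewrite (addrC z) /GRing.scale/=; field.
by rewrite nmN nmM ler_wpM2r ?nm_ge0.
Qed.

Lemma cderiv_horner (R : realType) (p : {poly R[i]}) (z : R[i]) :
  cderiv (horner p) z p^`().[z].
Proof.
elim/poly_ind: p => [|p c IH].
  rewrite deriv0 horner0; apply: cderiv_ext (cderiv_cst 0 z) => w.
  by rewrite horner0.
have := cderivD (cderivM IH (cderiv_id z)) (cderiv_cst c z).
have -> : (p * 'X + c%:P)^`() = p^`() * 'X + p.
  by rewrite derivD derivC addr0 derivM derivX mulr1.
rewrite addr0 mulr1 hornerD hornerM hornerX.
by apply: cderiv_ext => w; rewrite hornerD hornerM hornerX hornerC.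
Qed.

(** The condition [0 <= y] accounts for [ln], which is [0] on the nonpositive
    reals. *)
Lemma ln_le (R : realType) (x y : R) : 0 <= y -> x <= expR y -> ln x <= y.
Proof.
move=> y0 xy; have [x0|x0] := leP x 0; first by rewrite ln0.
by rewrite -[leRHS]expRK ler_ln ?posrE ?expR_gt0.
Qed.

Lemma max_modulus_le (R : realType) (f : R[i]^o -> R[i]^o) (r M : R) : 0 <= r ->
  (forall z, nm z = r -> nm (f z) <= M) -> max_modulus f r <= M.
Proof.
move=> r0 hM; apply: ge_sup.
  have nr : nm (r%:C : R[i]) = r by rewrite nm_real ger0_norm.
  by exists (nm (f r%:C)); exists r%:C; first exact: nr.
by move=> _ [z /= zr <-]; exact: hM.
Qed.

Lemma growth_order_le1 (R : realType) (f : R[i]^o -> R[i]^o) (C : R) : 1 <= C ->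
  (forall r : R, 1 <= r -> max_modulus f r <= expR (C * r)) ->
  (growth_order f <= 1)%E.
Proof.
move=> C1 hC; apply/lee_addgt0Pr => e e0.
pose r0 := expR (ln C / e + 1).
have C0 : 0 <= ln C by exact: ln_ge0.
have q0 : 0 <= ln C / e by rewrite divr_ge0// ltW.
apply: (@le_trans _ _ (ereal_sup
  [set (ln (ln (max_modulus f r)) / ln r)%:E | r in [set r | r0 < r]])).
  apply: ereal_inf_lbound; exists [set r | r0 < r] => //.
  by exists r0; split=> //; exact: num_real.
apply: ge_ereal_sup => _ [r /= hr <-].
have r1 : 1 < r.
  by apply: le_lt_trans hr; rewrite -expR0 ler_expR addr_ge0.
have rp : 0 < r by lra.
have lr : ln C / e + 1 < ln r by rewrite -[ltLHS]expRK ltr_ln ?posrE ?expR_gt0.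
have lr0 : 0 < ln r by lra.
rewrite -EFinD lee_fin ler_pdivrMr//.
have h1 : ln (max_modulus f r) <= C * r.
  by apply: ln_le; [rewrite mulr_ge0//; lra|apply: hC; exact: ltW].
apply: (@le_trans _ _ (ln C + ln r)).
  apply: ln_le; first by rewrite addr_ge0// ltW.
  by rewrite expRD !lnK ?posrE//; lra.
have : ln C <= e * ln r by rewrite mulrC -ler_pdivrMr//; lra.
lra.
Qed.

Unset Implicit Arguments.

Theorem proposition2p3 (R : realType) (a b : R[i]^o) (f : R[i]^o -> R[i]^o)
    (ha : a <> 0) (hb : b <> 0) (hab : a <> b)
    (hf : entire f) (hnc : nonconstant f)
    (hshare : share_allowing_ramification f (derive1 f) a)
    (hfb : forall z : R[i]^o, derive1 f z = b -> f z = b) :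
  transcendental f /\ (growth_order f <= 1)%E.
Proof.
have Hf := entire_holo hf.
have b0 : b != 0 by exact/eqP.
have ab : a != b by exact/eqP.
split.
  case=> p hp.
  have dp z : derive1 f z = p^`().[z].
    apply: (cderiv_unique (Hf z)).
    by apply: cderiv_ext (cderiv_horner p z) => w; rewrite hp.
  apply: (@no_polynomial R[i] p a b) => //; first exact/eqP.
  - rewrite ltnNge; apply/negP => sp; apply: hnc; exists p`_0 => z.
    by rewrite hp {1}(size1_polyC sp) hornerC.
  - by move=> z; rewrite -hp -dp; exact: (hshare z).1.
  - by move=> z; rewrite -hp -dp; exact: (hshare z).2.
  - by move=> z; rewrite -hp -dp; exact: hfb.
pose F z := f z - a.
have HF : holo F (derive1 f).
  by move=> z; have := cderivB (Hf z) (cderiv_cst a z); rewrite subr0; exact.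
have [K hK] : exists K, forall z, nm (F z) = 1 -> nm (derive1 f z) <= K.
  apply: (level_bound b0 ab HF) => z.
  - by move/eqP; rewrite subr_eq0 => /eqP; exact: (hshare z).1.
  - by move/(hshare z).2; rewrite /F => ->; rewrite subrr.
  - by move/hfb; rewrite /F => ->.
have [|A [C [C0 hA]]] := exp_type HF hK.
  by move=> hc; apply: hnc; exists (f 0) => z; have := hc z => /addIr.
have a0 := nm_ge0 a.
apply: (@growth_order_le1 _ _ (C * (1 + `|A|) + nm a + 1)).
  by rewrite lerDr addr_ge0// mulr_ge0// addr_ge0.
move=> r r1; apply: max_modulus_le => [|z zr]; first by lra.
have -> : f z = F z + a by rewrite /F subrK.
apply: le_trans (nmD _ _) _.
have h1 : nm (F z) <= expR (C * (r + `|A|)).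
  apply: le_trans (hA z) _; rewrite zr ler_expR ler_wpM2l// lerD2l.
  exact: ler_norm.
have e1 : 1 <= expR (C * (r + `|A|)).
  by rewrite -expR0 ler_expR mulr_ge0// addr_ge0//; lra.
have h2 : nm a <= expR (C * (r + `|A|)) * nm a by rewrite ler_peMl.
apply: (@le_trans _ _ (expR (C * (r + `|A|)) * (1 + nm a))); first by lra.
apply: (@le_trans _ _ (expR (C * (r + `|A|)) * expR (nm a))).
  by rewrite ler_wpM2l ?expR_ge0// expR_ge1Dx.
rewrite -expRD ler_expR.
have k1 : C * `|A| <= C * `|A| * r by rewrite ler_peMr// mulr_ge0.
have k2 : nm a <= nm a * r by rewrite ler_peMr.
lra.
Qed.
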